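(* Let $\Omega\subset\mathbb{C}$ be a connected open set containing the interval $(-1,1)$, let $\varrho$ be a smooth conformal metric density on $\Omega$, and let $f$ be a real $\varrho$-harmonic function of the unit disk $\mathbb{D}$ onto the interval $(-1,1)$. Let $\rho(u,v)=\varrho(u,0)$ for $(u,v)\in(-1,1)\times\mathbb{R}$. Then $f$ is $\rho$-harmonic. Assume further that the Gaussian curvature $\mathcal{K}_\rho$ of $\rho$ is non-negative. Then $$|\nabla f(z)|\,\frac{1-|z|^2}{1-|f(z)|^2}\le\frac{4}{\pi}\quad\text{for all } z\in\mathbb{D},$$ and this inequality is sharp, i.e. the constant $4/\pi$ cannot be replaced by a smaller constant valid for all such $\varrho$ and $f$.
   Context: $\mathbb{D}=\{z\in\mathbb{C}:|z|<1\}$. A smooth conformal metric density on a connected open set $\Omega\subset\mathbb{C}$ is a smooth positive function $\varrho:\Omega\to(0,\infty)$; points are written $w=u+iv$ or $(u,v)$. Its Gaussian curvature is $\mathcal{K}_\varrho(w)=-\dfrac{\Delta\log\varrho(w)}{\varrho(w)^2}$, where $\Delta$ is the usual Laplacian. In particular, for $\rho(u,v)=R(u)$ on the strip $(-1,1)\times\mathbb{R}$, $\mathcal{K}_\rho(u,v)=-\frac{1}{R(u)^2}\left(\frac{R'(u)}{R(u)}\right)'$. A $\mathcal{C}^2$ map $f:\mathbb{D}\to\Omega$ is $\varrho$-harmonic if $$f_{z\bar z}+\big((\log\varrho^2)_w\circ f\big)\,f_z f_{\bar z}=0\quad\text{on }\mathbb{D},$$ where subscripts $z,\bar z,w$ denote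 Wirtinger derivatives, e.g. $h_w=\frac12(h_u-i h_v)$. A real $\varrho$-harmonic function is a real-valued $f$ (with values in $\Omega\cap\mathbb{R}$) satisfying this equation. $\nabla f=(f_x,f_y)$ is the usual gradient. *)

(* Defs.v *)
From Stdlib Require Import Reals.
From Coquelicot Require Import Coquelicot.
Open Scope R_scope.

Definition unit_disk (z : C) : Prop := Cmod z < 1.

Definition strip (w : C) : Prop := -1 < Re w < 1.

Definition connected_set (Omega : C -> Prop) : Prop :=
  forall U V : C -> Prop,
    open U -> open V ->
    (forall w, Omega w -> U w \/ V w) ->
    (exists w, Omega w /\ U w) ->
    (exists w, Omega w /\ V w) ->
    exists w, Omega w /\ U w /\ V w.

(* [ex_diff_n] is a condition at a single point; imposed at every point of an
   open set it says that all partial derivatives up to order n exist and are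
   continuous there. *)
Definition Cn_on (n : nat) (Omega : C -> Prop) (h : C -> R) : Prop :=
  forall w, Omega w -> ex_diff_n (fun u v => h (u, v)) n (Re w) (Im w).

Definition smooth_on (Omega : C -> Prop) (h : C -> R) : Prop :=
  forall n : nat, Cn_on n Omega h.

Definition conformal_density (Omega : C -> Prop) (rho : C -> R) : Prop :=
  smooth_on Omega rho /\ forall w, Omega w -> 0 < rho w.

Definition partial_u (h : C -> R) (w : C) : R :=
  Derive (fun u => h (u, Im w)) (Re w).

Definition partial_v (h : C -> R) (w : C) : R :=
  Derive (fun v => h (Re w, v)) (Im w).

Definition laplacian (h : C -> R) (w : C) : R :=
  partial_u (partial_u h) w + partial_v (partial_v h) w.

Definition grad_norm (h : C -> R) (w : C) : R :=
  sqrt (partial_u h w ^ 2 + partial_v h w ^ 2).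

Definition curvature (rho : C -> R) (w : C) : R :=
  - (laplacian (fun w' => ln (rho w')) w / rho w ^ 2).

Definition Cpartial_u (h : C -> C) (w : C) : C :=
  (partial_u (fun w' => Re (h w')) w, partial_u (fun w' => Im (h w')) w).

Definition Cpartial_v (h : C -> C) (w : C) : C :=
  (partial_v (fun w' => Re (h w')) w, partial_v (fun w' => Im (h w')) w).

Definition wirtinger (h : C -> C) (w : C) : C :=
  ((Cpartial_u h w - Ci * Cpartial_v h w) / 2)%C.

Definition wirtinger_bar (h : C -> C) (w : C) : C :=
  ((Cpartial_u h w + Ci * Cpartial_v h w) / 2)%C.

Definition harmonic_map (Omega : C -> Prop) (rho : C -> R) (f : C -> C) : Prop :=
  (forall z, unit_disk z -> Omega (f z)) /\
  Cn_on 2 unit_disk (fun z => Re (f z)) /\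
  Cn_on 2 unit_disk (fun z => Im (f z)) /\
  forall z, unit_disk z ->
    (wirtinger_bar (wirtinger f) z
     + wirtinger (fun w => RtoC (ln (rho w ^ 2))) (f z)
       * wirtinger f z * wirtinger_bar f z)%C = RtoC 0.

Definition real_harmonic (Omega : C -> Prop) (rho : C -> R) (f : C -> R) : Prop :=
  harmonic_map Omega rho (fun z => RtoC (f z)).

Definition onto_interval (f : C -> R) : Prop :=
  forall t : R, -1 < t < 1 <-> exists z, unit_disk z /\ f z = t.

Definition setting (Omega : C -> Prop) (varrho : C -> R) (f : C -> R) : Prop :=
  open Omega /\
  connected_set Omega /\
  (forall t : R, -1 < t < 1 -> Omega (RtoC t)) /\
  conformal_density Omega varrho /\
  real_harmonic Omega varrho f /\
  onto_interval f.

Definition strip_density (varrho : C -> R) (w : C) : R := varrho (Re w, 0).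

(* Main.v *)
Require Import Defs.
From Stdlib Require Import Reals Lra Psatz Classical ClassicalEpsilon.
From Coquelicot Require Import Coquelicot.
Open Scope R_scope.

(** Write R(t) for the density at the point t of the real axis. For a
    real-valued f the equation of a harmonic map splits into
    Delta f + (log R)'(f) |grad f|^2 = 0 and an imaginary part carrying the
    v-derivative of the density. The first part sees the density only through
    R, and the second is void for a density that does not depend on v; so f is
    harmonic for the density of the strip ([real_harmonic_strip]).

    The gradient estimate rests on a change of variable in the target. If
    G' = R then Delta (G o f) = R(f) (Delta f + (log R)'(f) |grad f|^2) = 0:
    the function F = G o f is harmonic in the usual sense ([linearization]),
    with |grad F| = R(f) |grad f|. Two inequalities are then played against
    each other.

    - Schwarz lemma for harmonic functions with values in [A, B]
      ([gradient_bound]). On a circle |z| = r the mean of F is F(0) and its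
      first Fourier coefficient is PI r F_x(0). Among functions with values in
      [A, B] and a prescribed mean, the integral against the cosine is largest
      for a function equal to B on one arc and to A on the complementary arc
      ([bathtub]), which bounds the gradient at the centre by a multiple of
      sin (PI p) with p = (F(0) - A) / (B - A); moreover
      sin (PI p) <= 4 p (1 - p). Automorphisms of the disk carry the estimate
      to the other points. The result is
      PI (1 - |a|^2) |grad F(a)| <= 8 M N / (M + N)
      with M = F(a) - A and N = B - F(a).
    - Non-negative curvature means that log R is concave. For a log-concave R
      on [-m, m], with masses M and N on the two sides of t,
      R(t) (1/M + 1/N) >= 1/(t + m) + 1/(m - t)
      ([log_concave_isoperimetry]): half of the slope of log R at t can be
      subtracted on one side and added on the other.

    Multiplying, R(f(a)) cancels and (1 - |a|^2) |grad f(a)| <=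
    (4/PI) (m^2 - f(a)^2) / m remains, which is the assertion for m = 1. The
    primitive G may a priori misbehave near -1 and 1, and F is not assumed to
    extend to the closed disk; both problems are avoided by working on a circle
    of radius r < 1, along which |f| stays below some m < 1, and letting r tend
    to 1 at the end ([log_concave_gradient_estimate]).

    For the constant density the real part of (4/PI) arctan z maps the disk onto
    (-1, 1), and the modulus of its gradient at the origin is 4/PI. *)

(** * Concavity on an interval *)

Lemma MVT_open (f f' : R -> R) (a b : R) :
  a < b -> (forall c, a <= c <= b -> is_derive f c (f' c)) ->
  exists c, a < c < b /\ f b - f a = f' c * (b - a).
Proof.
  intros Hab Hf.
  destruct (MVT_cor2 f f' a b Hab) as (c & Hc & Hcab).
  - intros c Hc. apply is_derive_Reals. now apply Hf.
  - now exists c.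
Qed.

Lemma antitone_of_derive (f f' : R -> R) (a b : R) :
  a <= b -> (forall c, a <= c <= b -> is_derive f c (f' c)) ->
  (forall c, a <= c <= b -> f' c <= 0) -> f b <= f a.
Proof.
  intros Hab Hf Hneg.
  destruct (Rle_lt_or_eq_dec a b Hab) as [Hlt | ->]; [ | lra].
  destruct (MVT_open f f' a b Hlt Hf) as (c & Hc & E).
  specialize (Hneg c). nra.
Qed.

(** The derivative of a concave function is antitone, so the mean value of f'
    between s and t compares with f' t on the side that the sign of s - t
    requires. *)
Lemma tangent_above (f f' f'' : R -> R) (a b s t : R) :
  (forall c, a <= c <= b -> is_derive f c (f' c)) ->
  (forall c, a <= c <= b -> is_derive f' c (f'' c)) ->
  (forall c, a <= c <= b -> f'' c <= 0) ->
  a <= s <= b -> a <= t <= b ->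
  f s <= f t + f' t * (s - t).
Proof.
  intros Hf Hf' Hneg Hs Ht.
  assert (Hanti : forall x y, a <= x -> x <= y -> y <= b -> f' y <= f' x).
  { intros x y Hx Hxy Hy.
    apply antitone_of_derive with (f' := f''); auto;
      intros c Hc; [apply Hf' | apply Hneg]; lra. }
  destruct (Rtotal_order s t) as [Hst | [-> | Hst]]; [ | lra | ].
  - destruct (MVT_open f f' s t Hst) as (c & Hc & E).
    { intros c Hc. apply Hf. lra. }
    assert (f' t <= f' c) by (apply Hanti; lra). nra.
  - destruct (MVT_open f f' t s Hst) as (c & Hc & E).
    { intros c Hc. apply Hf. lra. }
    assert (f' c <= f' t) by (apply Hanti; lra). nra.
Qed.

(** The tangent at x lies above the graph at both ends of [0, PI/4], and a
    weighted sum of these two inequalities is the claim. *)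
Lemma sin_above_chord (x : R) :
  0 <= x <= PI / 4 -> sin (PI / 4) / (PI / 4) * x <= sin x.
Proof.
  intros Hx. assert (HP := PI_RGT_0).
  assert (Htan : forall s, 0 <= s <= PI / 4 ->
                   sin s <= sin x + cos x * (s - x)).
  { intros s Hs.
    apply tangent_above with (f'' := fun t => - sin t) (a := 0) (b := PI / 4);
      auto.
    - intros c _. auto_derive; auto. ring.
    - intros c _. auto_derive; auto. ring.
    - intros c Hc. assert (0 <= sin c) by (apply sin_ge_0; lra). lra. }
  assert (H0 := Htan 0 ltac:(lra)).
  assert (H1 := Htan (PI / 4) ltac:(lra)).
  rewrite sin_0 in H0.
  apply Rmult_le_reg_l with (PI / 4); [lra | ].
  replace (PI / 4 * (sin (PI / 4) / (PI / 4) * x)) with (sin (PI / 4) * x)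
    by (field; lra).
  nra.
Qed.

(** Both sides are symmetric about p = 1/2 and agree there. With u the
    distance to 1/2 the claim becomes sin (PI u / 2) >= sqrt 2 u, where
    equality holds at both ends of [0, 1/2], and concavity of the sine gives
    the rest. *)
Lemma sin_le_parabola (p : R) : 0 <= p <= 1 -> sin (PI * p) <= 4 * p * (1 - p).
Proof.
  intros Hp. assert (HP := PI_RGT_0).
  set (u := Rabs (p - / 2)).
  assert (Hu : 0 <= u <= / 2).
  { unfold u. split; [apply Rabs_pos | apply Rabs_le; lra]. }
  assert (Hu2 : u ^ 2 = (p - / 2) ^ 2) by (unfold u; apply pow2_abs).
  (* half-angle formula around the axis of symmetry p = 1/2 *)
  assert (E : sin (PI * p) = 1 - 2 * sin (PI / 2 * u) ^ 2).
  { replace (1 - 2 * sin (PI / 2 * u) ^ 2) with (cos (PI * u)).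
    - unfold u, Rabs. destruct (Rcase_abs (p - / 2)).
      + rewrite <- sin_shift. f_equal. field.
      + rewrite <- cos_shift. rewrite <- cos_neg. f_equal. field.
    - replace (PI * u) with (2 * (PI / 2 * u)) by field.
      rewrite cos_2a_sin. ring. }
  assert (Hs : sin (PI / 4) / (PI / 4) * (PI / 2 * u) <= sin (PI / 2 * u)).
  { apply sin_above_chord. nra. }
  replace (sin (PI / 4) / (PI / 4) * (PI / 2 * u)) with (2 * sin (PI / 4) * u)
    in Hs by (field; lra).
  assert (H4 : 0 <= sin (PI / 4)) by (apply sin_ge_0; lra).
  assert (H4' : sin (PI / 4) ^ 2 = / 2).
  { assert (H := sin2_cos2 (PI / 4)). unfold Rsqr in H.
    rewrite <- sin_cos_PI4 in H. lra. }
  assert (0 <= 2 * sin (PI / 4) * u)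
    by (apply Rmult_le_pos; [lra | tauto]).
  assert (Hsq : (2 * sin (PI / 4) * u) ^ 2 <= sin (PI / 2 * u) ^ 2)
    by (apply pow_incr; lra).
  replace ((2 * sin (PI / 4) * u) ^ 2) with (4 * sin (PI / 4) ^ 2 * u ^ 2)
    in Hsq by ring.
  rewrite H4', Hu2 in Hsq. nra.
Qed.

(** * Log-concave densities *)

(** Exponential decay at rate l is replaced by the rational function (1 + l d
    / 2)^(-2), which dominates it because 1 + x <= exp x. Unlike the
    exponential, it has the primitive d / (1 + l d / 2) without a case
    distinction on l = 0. *)
Lemma log_concave_envelope (r0 r1 l d : R) :
  0 < r0 -> 0 < r1 -> ln r1 <= ln r0 - l * d -> 0 < 1 + l * d / 2 ->
  r1 <= r0 / (1 + l * d / 2) ^ 2.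
Proof.
  intros H0 H1 Hln Hpos.
  assert (Hr : r1 <= r0 * exp (- (l * d))).
  { rewrite <- (exp_ln r1 H1), <- (exp_ln r0 H0) at 1.
    rewrite <- exp_plus.
    destruct (Rle_lt_or_eq_dec _ _ Hln) as [Hlt | ->].
    - left. apply exp_increasing. lra.
    - right. f_equal. }
  apply Rle_trans with (1 := Hr). unfold Rdiv.
  apply Rmult_le_compat_l; [lra | ].
  rewrite exp_Ropp. apply Rinv_le_contravar; [now apply pow_lt | ].
  replace (l * d) with (l * d / 2 + l * d / 2) at 2 by field.
  rewrite exp_plus.
  assert (H := exp_ineq1_le (l * d / 2)). nra.
Qed.

Section LogConcave.

Variables (rho G l l' : R -> R) (a b : R).
Hypothesis rho_pos : forall s, a <= s <= b -> 0 < rho s.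
Hypothesis G_derive : forall s, a <= s <= b -> is_derive G s (rho s).
Hypothesis ln_derive :
  forall s, a <= s <= b -> is_derive (fun u => ln (rho u)) s (l s).
Hypothesis l_derive : forall s, a <= s <= b -> is_derive l s (l' s).
Hypothesis l'_neg : forall s, a <= s <= b -> l' s <= 0.

Lemma primitive_increasing (s t : R) : a <= s -> s < t -> t <= b -> G s < G t.
Proof.
  intros Hs Hst Ht.
  destruct (MVT_open G rho s t Hst) as (c & Hc & E).
  - intros c Hc. apply G_derive. lra.
  - assert (0 < rho c) by (apply rho_pos; lra). nra.
Qed.

(** For e < t this reads rho t / M >= 1/x + l t / 2, where M is the mass of
    [e, t] and x its length; for e > t the sign of the last term changes. The
    tangent to the concave function log rho at t bounds rho by a rational
    envelope whose primitive is explicit, so that the sum k of G and this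
    primitive is antitone. *)
Lemma mean_density_bound (t e : R) :
  a <= t <= b -> a <= e <= b -> e <> t ->
  (G t - G e) / (t - e) * (1 + l t * (t - e) / 2) <= rho t.
Proof.
  intros Ht He Hne.
  assert (Hrt : 0 < rho t) by now apply rho_pos.
  destruct (Rle_or_lt (1 + l t * (t - e) / 2) 0) as [Hneg | Hpos].
  { assert (0 <= (G t - G e) / (t - e)); [ | nra].
    destruct (Rtotal_order e t) as [H | [H | H]]; [ | easy | ].
    - left. apply Rdiv_lt_0_compat; [ | lra].
      assert (G e < G t) by (apply primitive_increasing; lra). lra.
    - left. replace ((G t - G e) / (t - e)) with ((G e - G t) / (e - t))
        by (field; lra).
      apply Rdiv_lt_0_compat; [ | lra].
      assert (G t < G e) by (apply primitive_increasing; lra). lra. }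
  (* the weight is affine in s and positive at both ends *)
  assert (Hw : forall s, Rmin e t <= s <= Rmax e t ->
                 0 < 1 + l t * (t - s) / 2 /\ a <= s <= b).
  { intros s. unfold Rmin, Rmax. destruct (Rle_dec e t); intros Hs.
    - split; [ | lra]. destruct (Rle_or_lt 0 (l t)); nra.
    - split; [ | lra]. destruct (Rle_or_lt 0 (l t)); nra. }
  set (k := fun s => G s + rho t * ((t - s) / (1 + l t * (t - s) / 2))).
  set (k' := fun s => rho s - rho t / (1 + l t * (t - s) / 2) ^ 2).
  assert (Hk : forall s, Rmin e t <= s <= Rmax e t -> is_derive k s (k' s)).
  { intros s Hs. destruct (Hw s Hs) as (Hws & Hab). unfold k, k'.
    assert (HG := G_derive s Hab).
    auto_derive.
    - split; [now exists (rho s) | ]. split; [ | easy].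
      unfold Rdiv in Hws |- *. unfold Rminus in Hws. lra.
    - replace (Derive (fun x => G x) s) with (rho s)
        by (symmetry; now apply is_derive_unique).
      field. lra. }
  assert (Hk' : forall s, Rmin e t <= s <= Rmax e t -> k' s <= 0).
  { intros s Hs. destruct (Hw s Hs) as (Hws & Hab). unfold k'.
    apply Rle_minus. apply log_concave_envelope; auto.
    replace (ln (rho t) - l t * (t - s)) with (ln (rho t) + l t * (s - t))
      by ring.
    apply tangent_above with (f'' := l') (a := a) (b := b)
                             (f := fun u => ln (rho u)); auto. }
  assert (Kt : k t = G t) by (unfold k; field; lra).
  destruct (Rtotal_order e t) as [H | [H | H]]; [ | easy | ].
  - rewrite Rmin_left, Rmax_right in Hk, Hk' by lra.
    assert (Hm := antitone_of_derive k k' e t (Rlt_le _ _ H) Hk Hk').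
    rewrite Kt in Hm. unfold k in Hm.
    apply Rle_trans with (rho t * ((t - e) / (1 + l t * (t - e) / 2)) / (t - e)
                            * (1 + l t * (t - e) / 2)); [ | right; field; lra].
    apply Rmult_le_compat_r; [lra | ]. unfold Rdiv at 1 2.
    apply Rmult_le_compat_r; [left; apply Rinv_0_lt_compat | ]; lra.
  - rewrite Rmin_right, Rmax_left in Hk, Hk' by lra.
    assert (Hm := antitone_of_derive k k' t e (Rlt_le _ _ H) Hk Hk').
    rewrite Kt in Hm. unfold k in Hm.
    replace ((G t - G e) / (t - e)) with ((G e - G t) / (e - t))
      by (field; lra).
    apply Rle_trans with (- (rho t * ((t - e) / (1 + l t * (t - e) / 2)))
         / (e - t) * (1 + l t * (t - e) / 2)); [ | right; field; lra].
    apply Rmult_le_compat_r; [lra | ]. unfold Rdiv at 1 2.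
    apply Rmult_le_compat_r; [left; apply Rinv_0_lt_compat | ]; lra.
Qed.

(** This is rho t (1/M + 1/N) >= 1/(t - a) + 1/(b - t), with M and N the
    masses of the two sides of t, cleared of denominators: in the sum of the
    one-sided bounds for e = a and e = b the slope of log rho cancels. *)
Lemma log_concave_isoperimetry (t : R) :
  a < t < b ->
  (b - a) * ((G t - G a) * (G b - G t))
  <= rho t * ((t - a) * (b - t)) * (G b - G a).
Proof.
  intros Ht.
  assert (Ha := mean_density_bound t a ltac:(lra) ltac:(lra) ltac:(lra)).
  assert (Hb := mean_density_bound t b ltac:(lra) ltac:(lra) ltac:(lra)).
  assert (HM : G a < G t) by (apply primitive_increasing; lra).
  assert (HN : G t < G b) by (apply primitive_increasing; lra).
  assert (Ha' : (G t - G a) * (1 + l t * (t - a) / 2) <= rho t * (t - a)).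
  { apply Rmult_le_compat_r with (r := t - a) in Ha; [ | lra].
    replace ((G t - G a) / (t - a) * (1 + l t * (t - a) / 2) * (t - a))
      with ((G t - G a) * (1 + l t * (t - a) / 2)) in Ha by (field; lra).
    exact Ha. }
  assert (Hb' : (G b - G t) * (1 + l t * (t - b) / 2) <= rho t * (b - t)).
  { apply Rmult_le_compat_r with (r := b - t) in Hb; [ | lra].
    replace ((G t - G b) / (t - b) * (1 + l t * (t - b) / 2) * (b - t))
      with ((G b - G t) * (1 + l t * (t - b) / 2)) in Hb by (field; lra).
    exact Hb. }
  (* weighting the two bounds so that the slope l t cancels *)
  apply Rmult_le_compat_r with (r := (G b - G t) * (b - t)) in Ha';
    [ | apply Rmult_le_pos; lra].
  apply Rmult_le_compat_r with (r := (G t - G a) * (t - a)) in Hb';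
    [ | apply Rmult_le_pos; lra].
  nra.
Qed.

End LogConcave.

(** * The extremal problem on the circle *)

Lemma is_RInt_cos_minus (c u v : R) :
  is_RInt (fun s => cos s - c) u v ((sin v - c * v) - (sin u - c * u)).
Proof.
  apply (is_RInt_derive (fun s => sin s - c * s)).
  - intros s _. auto_derive; auto. ring.
  - intros s _. apply (continuous_minus cos (fun _ => c)).
    + apply continuous_cos.
    + apply continuous_const.
Qed.

Lemma ex_RInt_of_continuous (f : R -> R) (u v : R) :
  u <= v -> (forall s, u <= s <= v -> continuous f s) -> ex_RInt f u v.
Proof.
  intros Huv Hf. apply (ex_RInt_continuous (V := R_CompleteNormedModule)).
  intros s. rewrite Rmin_left, Rmax_right by easy. apply Hf.
Qed.

Lemma RInt_weighted_le (phi : R -> R) (w : R -> R) (k u v : R) :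
  u <= v -> (forall s, u <= s <= v -> continuous phi s) ->
  (forall s, u <= s <= v -> continuous w s) ->
  (forall s, u <= s <= v -> phi s * w s <= k * w s) ->
  RInt (fun s => phi s * w s) u v <= k * RInt w u v.
Proof.
  intros Huv Hphi Hw Hle.
  rewrite <- (RInt_scal w); [ | now apply ex_RInt_of_continuous].
  apply RInt_le; auto.
  - apply ex_RInt_of_continuous; auto. intros s Hs.
    apply (continuous_mult phi w); auto.
  - apply (ex_RInt_scal w). now apply ex_RInt_of_continuous.
  - intros s Hs. apply Hle. lra.
Qed.

(** The angle th is chosen so that the function equal to B on [-th, th] and to
    A elsewhere has mean m. Subtracting the constant cos th from the weight
    does not change the comparison between functions of the same mean, and
    makes the weight non-negative exactly on the arc where the extremal
    function takes its largest value. *)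
Lemma bathtub (phi : R -> R) (A B m : R) :
  A < B ->
  (forall s, - PI <= s <= PI -> continuous phi s) ->
  (forall s, - PI <= s <= PI -> A <= phi s <= B) ->
  RInt phi (- PI) PI = 2 * PI * m -> A <= m <= B ->
  RInt (fun s => phi s * cos s) (- PI) PI
  <= 2 * (B - A) * sin (PI * ((m - A) / (B - A))).
Proof.
  intros HAB Hcont Hphi Hmean Hm. assert (HP := PI_RGT_0).
  set (th := PI * ((m - A) / (B - A))).
  assert (Hth : 0 <= th <= PI).
  { unfold th. assert (0 <= (m - A) / (B - A) <= 1); [ | nra].
    split.
    - apply Rdiv_le_0_compat; lra.
    - apply Rmult_le_reg_r with (B - A); [lra | ].
      replace ((m - A) / (B - A) * (B - A)) with (m - A) by (field; lra). lra. }
  set (w := fun s => cos s - cos th).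
  assert (Hw : forall s, continuous w s).
  { intros s. apply (continuous_minus cos (fun _ => cos th)).
    - apply continuous_cos.
    - apply continuous_const. }
  assert (Ecos : forall s, cos s = cos (Rabs s)).
  { intros s. unfold Rabs. destruct (Rcase_abs s); [ | easy].
    now rewrite cos_neg. }
  assert (Hin : forall s, - th <= s <= th -> 0 <= w s).
  { intros s Hs. unfold w. rewrite (Ecos s).
    assert (Rabs s <= th) by (apply Rabs_le; lra).
    assert (cos th <= cos (Rabs s)); [ | lra].
    apply cos_decr_1; try lra; apply Rabs_pos. }
  assert (Hout : forall s, - PI <= s <= PI -> th <= Rabs s -> w s <= 0).
  { intros s Hs Hs'. unfold w. rewrite (Ecos s).
    assert (Rabs s <= PI) by (apply Rabs_le; lra).
    assert (cos (Rabs s) <= cos th); [ | lra].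
    apply cos_decr_1; try lra; apply Rabs_pos. }
  assert (Hex : forall u v, - PI <= u <= PI -> - PI <= v <= PI -> u <= v ->
                  ex_RInt (fun s => phi s * w s) u v).
  { intros u v Hu Hv Huv. apply ex_RInt_of_continuous; auto.
    intros s Hs. apply (continuous_mult phi w); auto. apply Hcont. lra. }
  assert (I1 : RInt (fun s => phi s * w s) (- PI) (- th)
               <= A * RInt w (- PI) (- th)).
  { apply RInt_weighted_le; auto; [lra | intros s Hs; apply Hcont; lra | ].
    intros s Hs. assert (H := Hphi s ltac:(lra)).
    assert (w s <= 0); [ | nra].
    apply Hout; [lra | ]. rewrite Rabs_left1; lra. }
  assert (I2 : RInt (fun s => phi s * w s) (- th) th <= B * RInt w (- th) th).
  { apply RInt_weighted_le; auto; [lra | intros s Hs; apply Hcont; lra | ].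
    intros s Hs. assert (H := Hphi s ltac:(lra)).
    assert (0 <= w s) by now apply Hin. nra. }
  assert (I3 : RInt (fun s => phi s * w s) th PI <= A * RInt w th PI).
  { apply RInt_weighted_le; auto; [lra | intros s Hs; apply Hcont; lra | ].
    intros s Hs. assert (H := Hphi s ltac:(lra)).
    assert (w s <= 0); [ | nra].
    apply Hout; [lra | ]. rewrite Rabs_pos_eq; lra. }
  assert (Iw : forall u v,
             RInt w u v = (sin v - cos th * v) - (sin u - cos th * u))
    by (intros u v; apply is_RInt_unique, is_RInt_cos_minus).
  rewrite Iw in I1, I2, I3.
  rewrite !sin_neg, sin_PI in I1. rewrite sin_neg in I2. rewrite sin_PI in I3.
  assert (Esplit : RInt (fun s => phi s * cos s) (- PI) PI
                   = RInt (fun s => phi s * w s) (- PI) PI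
                     + cos th * RInt phi (- PI) PI).
  { rewrite <- (RInt_scal phi).
    2: { apply ex_RInt_of_continuous; [lra | auto]. }
    rewrite <- (RInt_plus (V := R_CompleteNormedModule)).
    - apply RInt_ext. intros s _.
      change (phi s * cos s = phi s * (cos s - cos th) + cos th * phi s). ring.
    - apply Hex; lra.
    - apply (ex_RInt_scal phi).
      apply ex_RInt_of_continuous; [lra | auto]. }
  rewrite Esplit, Hmean.
  rewrite <- (RInt_Chasles (fun s => phi s * w s) (- PI) (- th) PI)
    by (apply Hex; lra).
  rewrite <- (RInt_Chasles (fun s => phi s * w s) (- th) th PI)
    by (apply Hex; lra).
  change plus with Rplus. cbv beta.
  assert (Eth : th * (B - A) = PI * (m - A)) by (unfold th; field; lra).
  apply (f_equal (Rmult (cos th))) in Eth.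
  lra.
Qed.

(** * Complex differentiability in real coordinates *)

(** One partial derivative near the point, continuous at it, and the other one
    at the point alone suffice. *)
Lemma differentiable_of_partials (f fx : R -> R -> R) (x y fy : R) :
  locally_2d (fun u v => is_derive (fun t => f t v) u (fx u v)) x y ->
  is_derive (fun t => f x t) y fy -> continuity_2d_pt fx x y ->
  differentiable_pt_lim f x y (fx x y) fy.
Proof.
  intros Hx Hy Hc. apply filterdiff_differentiable_pt_lim.
  apply is_derive_filterdiff; auto.
  - now apply locally_2d_locally in Hx.
  - now apply continuity_2d_pt_filterlim in Hc.
Qed.

Lemma differentiable_plus (f g : R -> R -> R) (x y fx fy gx gy : R) :
  differentiable_pt_lim f x y fx fy -> differentiable_pt_lim g x y gx gy ->
  differentiable_pt_lim (fun u v => f u v + g u v) x y (fx + gx) (fy + gy).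
Proof.
  intros Hf Hg.
  replace (fx + gx) with (1 * fx + 1 * gx) by ring.
  replace (fy + gy) with (1 * fy + 1 * gy) by ring.
  apply (differentiable_pt_lim_comp Rplus); auto.
  apply (differentiable_of_partials _ (fun _ _ => 1)).
  - exists (mkposreal 1 Rlt_0_1). intros u v _ _. auto_derive; auto.
  - auto_derive; auto.
  - apply continuity_2d_pt_const.
Qed.

Lemma differentiable_mult (f g : R -> R -> R) (x y fx fy gx gy : R) :
  differentiable_pt_lim f x y fx fy -> differentiable_pt_lim g x y gx gy ->
  differentiable_pt_lim (fun u v => f u v * g u v) x y
    (g x y * fx + f x y * gx) (g x y * fy + f x y * gy).
Proof.
  intros Hf Hg.
  apply (differentiable_pt_lim_comp Rmult); auto.
  apply (differentiable_of_partials _ (fun _ v => v)).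
  - exists (mkposreal 1 Rlt_0_1). intros u v _ _. auto_derive; auto. ring.
  - auto_derive; auto. ring.
  - apply continuity_2d_pt_id2.
Qed.

Lemma differentiable_opp (f : R -> R -> R) (x y fx fy : R) :
  differentiable_pt_lim f x y fx fy ->
  differentiable_pt_lim (fun u v => - f u v) x y (- fx) (- fy).
Proof.
  intros Hf.
  replace (- fx) with (- 1 * fx + 0 * fx) by ring.
  replace (- fy) with (- 1 * fy + 0 * fy) by ring.
  apply (differentiable_pt_lim_comp (fun s _ => - s) f f); auto.
  apply differentiable_pt_lim_proj1_0. apply is_derive_Reals.
  auto_derive; auto.
Qed.

(** The Cauchy-Riemann equations at z in differential form: the real
    differential of H at z is multiplication by d. *)
Definition holo_at (H : C -> C) (z d : C) : Prop :=
  differentiable_pt_lim (fun u v => Re (H (u, v))) (Re z) (Im z)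
    (Re d) (- Im d) /\
  differentiable_pt_lim (fun u v => Im (H (u, v))) (Re z) (Im z)
    (Im d) (Re d).

Lemma holo_eq (H : C -> C) (z d e : C) : holo_at H z d -> d = e -> holo_at H z e.
Proof. now intros Hd <-. Qed.

Lemma differentiable_affine (a b c x y : R) :
  differentiable_pt_lim (fun u v => a * u + b * v + c) x y a b.
Proof.
  apply (differentiable_of_partials _ (fun _ _ => a)).
  - apply locally_2d_forall. intros u v. auto_derive; [easy | ring].
  - auto_derive; [easy | ring].
  - apply continuity_2d_pt_const.
Qed.

Lemma holo_const (c z : C) : holo_at (fun _ => c) z 0%C.
Proof.
  split; cbn.
  - rewrite Ropp_0.
    eapply differentiable_pt_lim_ext, (differentiable_affine 0 0 (Re c)).
    apply locally_2d_forall. intros u v. ring.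
  - eapply differentiable_pt_lim_ext, (differentiable_affine 0 0 (Im c)).
    apply locally_2d_forall. intros u v. ring.
Qed.

Lemma holo_id (z : C) : holo_at (fun w => w) z 1%C.
Proof.
  split; cbn.
  - rewrite Ropp_0.
    eapply differentiable_pt_lim_ext, (differentiable_affine 1 0 0).
    apply locally_2d_forall. intros u v. ring.
  - eapply differentiable_pt_lim_ext, (differentiable_affine 0 1 0).
    apply locally_2d_forall. intros u v. ring.
Qed.

Lemma holo_plus (H K : C -> C) (z d e : C) :
  holo_at H z d -> holo_at K z e ->
  holo_at (fun w => H w + K w)%C z (d + e)%C.
Proof.
  intros (H1 & H2) (K1 & K2). split; cbn.
  - rewrite Ropp_plus_distr. now apply differentiable_plus.
  - now apply differentiable_plus.
Qed.

Lemma C_eta (z : C) : (Re z, Im z) = z.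
Proof. now destruct z. Qed.

Lemma differentiable_eq (f : R -> R -> R) (x y a b a' b' : R) :
  differentiable_pt_lim f x y a b -> a = a' -> b = b' ->
  differentiable_pt_lim f x y a' b'.
Proof. now intros H <- <-. Qed.

Lemma holo_mult (H K : C -> C) (z d e : C) :
  holo_at H z d -> holo_at K z e ->
  holo_at (fun w => H w * K w)%C z (d * K z + H z * e)%C.
Proof.
  intros (H1 & H2) (K1 & K2).
  assert (A1 := differentiable_mult _ _ _ _ _ _ _ _ H1 K1).
  assert (A2 := differentiable_opp _ _ _ _ _
                  (differentiable_mult _ _ _ _ _ _ _ _ H2 K2)).
  assert (A3 := differentiable_mult _ _ _ _ _ _ _ _ H1 K2).
  assert (A4 := differentiable_mult _ _ _ _ _ _ _ _ H2 K1).
  cbv beta in A1, A2, A3, A4. rewrite C_eta in A1, A2, A3, A4.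
  split.
  - eapply differentiable_eq.
    + exact (differentiable_plus _ _ _ _ _ _ _ _ A1 A2).
    + cbn. unfold Re, Im. ring.
    + cbn. unfold Re, Im. ring.
  - eapply differentiable_eq.
    + exact (differentiable_plus _ _ _ _ _ _ _ _ A3 A4).
    + cbn. unfold Re, Im. ring.
    + cbn. unfold Re, Im. ring.
Qed.

Lemma holo_comp (H K : C -> C) (z d e : C) :
  holo_at H (K z) d -> holo_at K z e ->
  holo_at (fun w => H (K w)) z (d * e)%C.
Proof.
  intros (H1 & H2) (K1 & K2).
  split.
  - apply differentiable_pt_lim_ext
      with (f1 := fun u v => Re (H (Re (K (u, v)), Im (K (u, v))))).
    { exists (mkposreal 1 Rlt_0_1). intros u v _ _. now rewrite C_eta. }
    eapply differentiable_eq.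
    + apply (differentiable_pt_lim_comp (fun u v => Re (H (u, v)))
               (fun u v => Re (K (u, v))) (fun u v => Im (K (u, v))));
        [ | exact K1 | exact K2].
      rewrite C_eta. exact H1.
    + cbn. unfold Re, Im. ring.
    + cbn. unfold Re, Im. ring.
  - apply differentiable_pt_lim_ext
      with (f1 := fun u v => Im (H (Re (K (u, v)), Im (K (u, v))))).
    { exists (mkposreal 1 Rlt_0_1). intros u v _ _. now rewrite C_eta. }
    eapply differentiable_eq.
    + apply (differentiable_pt_lim_comp (fun u v => Im (H (u, v)))
               (fun u v => Re (K (u, v))) (fun u v => Im (K (u, v))));
        [ | exact K1 | exact K2].
      rewrite C_eta. exact H2.
    + cbn. unfold Re, Im. ring.
    + cbn. unfold Re, Im. ring.
Qed.

Lemma norm2_pos (z : C) : z <> 0%C -> 0 < Re z ^ 2 + Im z ^ 2.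
Proof.
  intros Hz. apply Cmod_gt_0 in Hz. rewrite <- Cmod2_alt. now apply pow_lt.
Qed.

Lemma holo_inv (z : C) : z <> 0%C -> holo_at Cinv z (- (/ z * / z))%C.
Proof.
  intros Hz. apply norm2_pos in Hz. destruct z as (x, y). cbn in Hz.
  assert (Hloc : locally_2d (fun u v => u ^ 2 + v ^ 2 <> 0) x y).
  { apply (continuity_2d_pt_neq_0 (fun u v => u ^ 2 + v ^ 2)); [ | cbn; lra].
    apply continuity_2d_pt_plus; cbn;
      repeat apply continuity_2d_pt_mult;
      auto using continuity_2d_pt_id1, continuity_2d_pt_id2,
                 continuity_2d_pt_const. }
  assert (Hc : forall f : R -> R -> R, continuity_2d_pt f x y ->
                 continuity_2d_pt (fun u v => f u v / (u ^ 2 + v ^ 2) ^ 2) x y).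
  { intros f Hf. apply continuity_2d_pt_mult; auto.
    apply continuity_2d_pt_inv; [ | cbn; nra].
    cbn. repeat (apply continuity_2d_pt_mult || apply continuity_2d_pt_plus);
      auto using continuity_2d_pt_id1, continuity_2d_pt_id2,
                 continuity_2d_pt_const. }
  split; cbn -[pow].
  - eapply differentiable_eq.
    + apply (differentiable_of_partials _
               (fun u v => (v * v - u * u) / (u ^ 2 + v ^ 2) ^ 2)).
      * revert Hloc. apply locally_2d_impl, locally_2d_forall. intros u v Huv.
        auto_derive; cbn in *; [now rewrite !Rmult_1_r in * | ].
        field. now rewrite !Rmult_1_r in *.
      * instantiate (1 := - (2 * x * y) / (x ^ 2 + y ^ 2) ^ 2).
        auto_derive; cbn in *; [lra | ]. field. lra.
      * apply Hc. apply continuity_2d_pt_minus;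
          apply continuity_2d_pt_mult;
          auto using continuity_2d_pt_id1, continuity_2d_pt_id2.
    + cbn in *. field. lra.
    + cbn in *. field. lra.
  - eapply differentiable_eq.
    + apply (differentiable_of_partials _
               (fun u v => (u * v + u * v) / (u ^ 2 + v ^ 2) ^ 2)).
      * revert Hloc. apply locally_2d_impl, locally_2d_forall. intros u v Huv.
        auto_derive; cbn in *; [now rewrite !Rmult_1_r in * | ].
        field. now rewrite !Rmult_1_r in *.
      * instantiate (1 := (y * y - x * x) / (x ^ 2 + y ^ 2) ^ 2).
        auto_derive; cbn in *; [lra | ]. field. lra.
      * apply Hc. apply continuity_2d_pt_plus;
          apply continuity_2d_pt_mult;
          auto using continuity_2d_pt_id1, continuity_2d_pt_id2.
    + cbn in *. field. lra.
    + cbn in *. field. lra.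
Qed.

(** * Continuity and derivatives along curves *)

Lemma derive_along (f : C -> R) (gx gy : R -> R) (t fx fy dx dy : R) :
  differentiable_pt_lim (fun u v => f (u, v)) (gx t) (gy t) fx fy ->
  is_derive gx t dx -> is_derive gy t dy ->
  is_derive (fun s => f (gx s, gy s)) t (fx * dx + fy * dy).
Proof.
  intros Hf Hx Hy. apply is_derive_Reals.
  apply (derivable_pt_lim_comp_2d (fun u v => f (u, v)));
    auto; now apply is_derive_Reals.
Qed.

Section Continuity.

Context {U : UniformSpace}.

Lemma continuous_to_C (f : U -> C) (x : U) :
  continuous (fun u => Re (f u)) x -> continuous (fun u => Im (f u)) x ->
  continuous (U := C_UniformSpace) f x.
Proof.
  intros H1 H2.
  apply continuous_ext with (f := fun u => (Re (f u), Im (f u))).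
  { intros u. apply C_eta. }
  apply (continuous_comp_2 (fun u => Re (f u)) (fun u => Im (f u))
           (fun a b : R => (a, b))); auto.
  apply continuous_ext with (f := fun u => u); [now intros (a, b) | ].
  apply continuous_id.
Qed.

Lemma continuous_Re (f : U -> C) (x : U) :
  continuous (U := C_UniformSpace) f x -> continuous (fun u => Re (f u)) x.
Proof.
  intros Hf. apply continuous_comp with (1 := Hf).
  destruct (f x). apply (continuous_fst (U := R_UniformSpace)).
Qed.

Lemma continuous_Im (f : U -> C) (x : U) :
  continuous (U := C_UniformSpace) f x -> continuous (fun u => Im (f u)) x.
Proof.
  intros Hf. apply continuous_comp with (1 := Hf).
  destruct (f x). apply (continuous_snd (U := R_UniformSpace)).
Qed.

Lemma continuous_Cplus (f g : U -> C) (x : U) :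
  continuous (U := C_UniformSpace) f x ->
  continuous (U := C_UniformSpace) g x ->
  continuous (U := C_UniformSpace) (fun u => (f u + g u)%C) x.
Proof.
  intros Hf Hg. apply continuous_to_C; cbn.
  - apply (continuous_plus (fun u => Re (f u)) (fun u => Re (g u)));
      now apply continuous_Re.
  - apply (continuous_plus (fun u => Im (f u)) (fun u => Im (g u)));
      now apply continuous_Im.
Qed.

Lemma continuous_Cmult (f g : U -> C) (x : U) :
  continuous (U := C_UniformSpace) f x ->
  continuous (U := C_UniformSpace) g x ->
  continuous (U := C_UniformSpace) (fun u => (f u * g u)%C) x.
Proof.
  intros Hf Hg.
  assert (Hf1 := continuous_Re _ _ Hf). assert (Hf2 := continuous_Im _ _ Hf).
  assert (Hg1 := continuous_Re _ _ Hg). assert (Hg2 := continuous_Im _ _ Hg).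
  apply continuous_to_C; cbn.
  - apply (continuous_minus (fun u => Re (f u) * Re (g u))
                            (fun u => Im (f u) * Im (g u)));
      now apply (continuous_mult (K := R_AbsRing)).
  - apply (continuous_plus (fun u => Re (f u) * Im (g u))
                           (fun u => Im (f u) * Re (g u)));
      now apply (continuous_mult (K := R_AbsRing)).
Qed.

End Continuity.

Lemma differentiable_continuous (f : C -> R) (z : C) (a b : R) :
  differentiable_pt_lim (fun u v => f (u, v)) (Re z) (Im z) a b ->
  continuous (T := C_UniformSpace) f z.
Proof.
  intros Hf.
  assert (Hc : continuity_2d_pt (fun u v => f (u, v)) (Re z) (Im z))
    by (apply differentiable_continuity_pt; now exists a, b).
  apply continuity_2d_pt_filterlim in Hc. rewrite C_eta in Hc.
  unfold continuous.
  apply filterlim_ext with (2 := Hc). intros (u, v). easy.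
Qed.

Lemma holo_continuous (H : C -> C) (z d : C) :
  holo_at H z d -> continuous (T := C_UniformSpace) (U := C_UniformSpace) H z.
Proof.
  intros (H1 & H2).
  apply (continuous_to_C (U := C_UniformSpace)).
  - exact (differentiable_continuous (fun w => Re (H w)) _ _ _ H1).
  - exact (differentiable_continuous (fun w => Im (H w)) _ _ _ H2).
Qed.

(** * The mean value property *)

Definition polar (r t : R) : C := (r * cos t, r * sin t).

Lemma polar_0 (t : R) : polar 0 t = 0%C.
Proof. unfold polar, RtoC. f_equal; ring. Qed.

Lemma Cmod_polar (r t : R) : Cmod (polar r t) = Rabs r.
Proof.
  unfold Cmod, polar; cbn [fst snd].
  replace ((r * cos t) ^ 2 + (r * sin t) ^ 2) with (Rsqr r).
  - apply sqrt_Rsqr_abs.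
  - assert (H := sin2_cos2 t). unfold Rsqr in *. nra.
Qed.

Lemma polar_in_disk (r t : R) : -1 < r < 1 -> unit_disk (polar r t).
Proof. intros Hr. unfold unit_disk. rewrite Cmod_polar. now apply Rabs_def1. Qed.

Lemma polar_scale (r t : R) : polar r t = (r * polar 1 t)%C.
Proof. unfold polar, RtoC, Cmult; cbn. f_equal; ring. Qed.

Lemma continuous_polar (r t : R) :
  continuous (U := C_UniformSpace) (fun p : R * R => polar (fst p) (snd p))
    (r, t).
Proof.
  assert (H1 : continuous (fun p : R * R => fst p) (r, t))
    by apply (continuous_fst (U := R_UniformSpace)).
  assert (H2 : continuous (fun p : R * R => snd p) (r, t))
    by apply (continuous_snd (U := R_UniformSpace)).
  apply continuous_to_C; cbn.
  - apply (continuous_mult (K := R_AbsRing) fst (fun p => cos (snd p))); auto.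
    apply (continuous_comp snd cos); auto. apply continuous_cos.
  - apply (continuous_mult (K := R_AbsRing) fst (fun p => sin (snd p))); auto.
    apply (continuous_comp snd sin); auto. apply continuous_sin.
Qed.

Lemma derive_ray (f : C -> R) (d : C) (r t : R) :
  differentiable_pt_lim (fun u v => f (u, v))
    (Re (polar r t)) (Im (polar r t)) (Re d) (- Im d) ->
  is_derive (fun s => f (polar s t)) r (Re (d * polar 1 t)%C).
Proof.
  intros Hf.
  replace (Re (d * polar 1 t)%C) with (Re d * cos t + - Im d * sin t)
    by (cbn; unfold Re, Im; ring).
  apply (derive_along f (fun s => s * cos t) (fun s => s * sin t)); auto;
    auto_derive; auto; ring.
Qed.

(** The velocity of the point of angle t is i z, and Re (i d z) = - Im (d
    z). *)
Lemma derive_circle (f : C -> R) (d : C) (r t : R) :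
  differentiable_pt_lim (fun u v => f (u, v))
    (Re (polar r t)) (Im (polar r t)) (Re d) (- Im d) ->
  is_derive (fun s => f (polar r s)) t (- Im (d * polar r t)%C).
Proof.
  intros Hf.
  replace (- Im (d * polar r t)%C)
    with (Re d * - (r * sin t) + - Im d * (r * cos t))
    by (cbn; unfold Re, Im; ring).
  apply (derive_along f (fun s => r * cos s) (fun s => r * sin s)); auto;
    auto_derive; auto; ring.
Qed.

(** Differentiation under the integral sign, with the derivative of the
    integrand given explicitly. The parameter ranges over an open interval, so
    that negative radii are allowed and the radius 0 is an interior point. *)
Lemma is_derive_RInt_circle (f df : R -> R -> R) (r0 r1 : R) (r : R) :
  r0 < r < r1 ->
  (forall s t, r0 < s < r1 -> is_derive (fun u => f u t) s (df s t)) ->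
  (forall s t, r0 < s < r1 -> continuous (f s) t) ->
  (forall t, continuous (fun p : R * R => df (fst p) (snd p)) (r, t)) ->
  is_derive (fun s => RInt (f s) (- PI) PI) r (RInt (df r) (- PI) PI).
Proof.
  intros Hr Hd Hc Hdc. assert (HP := PI_RGT_0).
  assert (Hpos : 0 < Rmin (r - r0) (r1 - r)) by (apply Rmin_pos; lra).
  assert (Hnear : forall s, Rabs (s - r) < Rmin (r - r0) (r1 - r) ->
                    r0 < s < r1).
  { intros s Hs. apply Rabs_def2 in Hs.
    assert (H1 := Rmin_l (r - r0) (r1 - r)).
    assert (H2 := Rmin_r (r - r0) (r1 - r)). lra. }
  assert (HD : forall s t, r0 < s < r1 -> Derive (fun u => f u t) s = df s t)
    by (intros s t Hs; apply is_derive_unique; auto).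
  replace (RInt (df r) (- PI) PI)
    with (RInt (fun t => Derive (fun u => f u t) r) (- PI) PI)
    by (apply RInt_ext; auto).
  apply is_derive_RInt_param.
  - exists (mkposreal _ Hpos). intros s Hs t _. exists (df s t).
    apply Hd, Hnear, Hs.
  - intros t _.
    apply continuity_2d_pt_ext_loc with (f := df).
    + exists (mkposreal _ Hpos). intros u v Hu _. symmetry. apply HD, Hnear, Hu.
    + apply continuity_2d_pt_filterlim. apply Hdc.
  - exists (mkposreal _ Hpos). intros s Hs.
    apply ex_RInt_of_continuous; [lra | ]. intros t _. apply Hc, Hnear, Hs.
Qed.

(** Away from 0 the factor s cancels, and the mean value theorem evaluates the
    derivative at an interior point of [0, r]. *)
Lemma constant_of_scaled_derive (f f' : R -> R) (r : R) :
  0 <= r -> (forall s, 0 <= s <= r -> is_derive f s (f' s)) ->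
  (forall s, 0 <= s <= r -> s * f' s = 0) -> f r = f 0.
Proof.
  intros [Hr | <-] Hf Hz; [ | easy].
  destruct (MVT_open f f' 0 r Hr Hf) as (c & Hc & E).
  specialize (Hz c ltac:(lra)). nra.
Qed.

Lemma continuous_polar_r (r t : R) :
  continuous (U := C_UniformSpace) (fun s => polar r s) t.
Proof.
  apply continuous_to_C; cbn.
  - apply (continuous_mult (K := R_AbsRing) (fun _ => r) cos).
    + apply continuous_const.
    + apply continuous_cos.
  - apply (continuous_mult (K := R_AbsRing) (fun _ => r) sin).
    + apply continuous_const.
    + apply continuous_sin.
Qed.

Lemma continuous_on_circle (K : C -> C) (r t : R) :
  (forall z, unit_disk z ->
     continuous (T := C_UniformSpace) (U := C_UniformSpace) K z) ->
  -1 < r < 1 ->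
  continuous (U := C_UniformSpace) (fun s => K (polar r s)) t.
Proof.
  intros HK Hr.
  apply (continuous_comp (fun s => polar r s) K).
  - apply continuous_polar_r.
  - now apply HK, polar_in_disk.
Qed.

Section Circle.

Variables (H H' : C -> C).
Hypothesis H_holo : forall z, unit_disk z -> holo_at H z (H' z).
Hypothesis H'_continuous : forall z, unit_disk z ->
  continuous (T := C_UniformSpace) (U := C_UniformSpace) H' z.

(** With P(r) the integral, r P'(r) is the integral of Re (z H'(z)) over the
    circle. Since the angular derivative of H is i z H'(z), this is the
    integral of the angular derivative of Im H over a full turn, that is 0. *)
Lemma holo_mean_value (r : R) :
  0 <= r < 1 ->
  RInt (fun t => Re (H (polar r t))) (- PI) PI = 2 * PI * Re (H 0%C).
Proof.
  intros Hr. assert (HP := PI_RGT_0).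
  rewrite (constant_of_scaled_derive
             (fun s => RInt (fun t => Re (H (polar s t))) (- PI) PI)
             (fun s => RInt (fun t => Re (H' (polar s t) * polar 1 t)%C)
                         (- PI) PI) r); [ | lra | | ].
  - rewrite (RInt_ext _ (fun _ => Re (H 0%C)))
      by (intros t _; now rewrite polar_0).
    rewrite RInt_const.
    change ((PI - - PI) * Re (H 0%C) = 2 * PI * Re (H 0%C)). ring.
  - intros s Hs.
    apply (is_derive_RInt_circle (fun u t => Re (H (polar u t)))
             (fun u t => Re (H' (polar u t) * polar 1 t)%C) (-1) 1); [lra | | | ].
    + intros u t Hu. apply (derive_ray (fun z => Re (H z))).
      now apply H_holo, polar_in_disk.
    + intros u t Hu. apply continuous_Re.
      apply (continuous_on_circle H); auto.
      intros z Hz. now apply (holo_continuous H z (H' z)), H_holo.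
    + intros t. apply continuous_Re, continuous_Cmult.
      * apply (continuous_comp (fun p : R * R => polar (fst p) (snd p)) H').
        -- apply continuous_polar.
        -- apply H'_continuous, polar_in_disk. cbn. lra.
      * apply (continuous_comp (fun p : R * R => snd p) (fun t => polar 1 t)).
        -- apply (continuous_snd (U := R_UniformSpace)).
        -- apply continuous_polar_r.
  - intros s Hs.
    assert (Hcont : forall t, continuous
                      (fun t => Re (H' (polar s t) * polar s t)%C) t).
    { intros t. apply continuous_Re, continuous_Cmult.
      - apply (continuous_on_circle H'); auto; lra.
      - apply continuous_polar_r. }
    transitivity (RInt (fun t => Re (H' (polar s t) * polar s t)%C) (- PI) PI).
    { rewrite <- (RInt_scal (fun t => Re (H' (polar s t) * polar 1 t)%C)).
      - apply RInt_ext. intros t _.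
        change (s * Re (H' (polar s t) * polar 1 t)%C
                = Re (H' (polar s t) * polar s t)%C).
        rewrite (polar_scale s t) at 3.
        cbn. unfold Re, Im. ring.
      - apply ex_RInt_of_continuous; [lra | ]. intros t _.
        apply continuous_Re, continuous_Cmult.
        + apply (continuous_on_circle H'); auto; lra.
        + apply continuous_polar_r. }
    (* z H'(z) is the angular derivative of H / i *)
    assert (Hder : forall t, is_derive (fun t => Im (H (polar s t))) t
                               (Re (H' (polar s t) * polar s t)%C)).
    { intros t.
      replace (Re (H' (polar s t) * polar s t)%C)
        with (- Im ((- (Ci * H' (polar s t))) * polar s t)%C)
        by (cbn; unfold Re, Im; ring).
      apply (derive_circle (fun z => Im (H z))).
      eapply differentiable_eq.
      - apply H_holo, polar_in_disk. lra.
      - cbn. unfold Re, Im. ring.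
      - cbn. unfold Re, Im. ring. }
    apply is_RInt_unique.
    replace 0 with (minus (Im (H (polar s PI))) (Im (H (polar s (- PI))))).
    + apply (is_RInt_derive (fun t => Im (H (polar s t)))); auto.
    + replace (polar s (- PI)) with (polar s PI).
      * apply (minus_eq_zero (G := R_AbelianGroup)).
      * unfold polar. now rewrite cos_neg, sin_neg, sin_PI, Ropp_0.
Qed.

End Circle.

(** * Fourier coefficients of harmonic functions *)

(** Here g = F_x - i F_y. Harmonicity of F is expressed by the Cauchy-Riemann
    equations of g, so that the mean value property of holomorphic functions
    applies to g and to z g(z). *)
Definition harmonic_with (F : C -> R) (g g' : C -> C) : Prop :=
  forall z, unit_disk z ->
    differentiable_pt_lim (fun u v => F (u, v)) (Re z) (Im z)
      (Re (g z)) (- Im (g z)) /\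
    holo_at g z (g' z) /\
    continuous (T := C_UniformSpace) (U := C_UniformSpace) g' z.

Section Fourier.

Variables (F : C -> R) (g g' : C -> C).
Hypothesis F_harmonic : harmonic_with F g g'.

Lemma continuous_gradient (z : C) : unit_disk z ->
  continuous (T := C_UniformSpace) (U := C_UniformSpace) g z.
Proof. intros Hz. apply (holo_continuous g z (g' z)), F_harmonic, Hz. Qed.

Lemma continuous_on_circle_F (r t : R) :
  -1 < r < 1 -> continuous (fun s => F (polar r s)) t.
Proof.
  intros Hr. apply (continuous_comp (fun s => polar r s) F).
  - apply continuous_polar_r.
  - eapply differentiable_continuous, F_harmonic. now apply polar_in_disk.
Qed.

(** The weight w is 1 for the mean and the cosine for the first Fourier
    coefficient. *)
Lemma derive_circle_mean (w : R -> R) (r : R) :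
  (forall t, continuous w t) -> -1 < r < 1 ->
  is_derive (fun s => RInt (fun t => F (polar s t) * w t) (- PI) PI) r
    (RInt (fun t => Re (g (polar r t) * polar 1 t)%C * w t) (- PI) PI).
Proof.
  intros Hw Hr.
  apply (is_derive_RInt_circle (fun s t => F (polar s t) * w t)
           (fun s t => Re (g (polar s t) * polar 1 t)%C * w t) (-1) 1); auto.
  - intros s t Hs.
    assert (HF : is_derive (fun u => F (polar u t)) s
                   (Re (g (polar s t) * polar 1 t)%C))
      by now apply derive_ray, F_harmonic, polar_in_disk.
    apply (is_derive_ext (fun u => w t * F (polar u t))).
    { intros u. apply Rmult_comm. }
    rewrite Rmult_comm. now apply is_derive_scal.
  - intros s t Hs. apply (continuous_mult (K := R_AbsRing)); auto.
    now apply continuous_on_circle_F.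
  - intros t.
    assert (Hsnd : continuous (fun p : R * R => snd p) (r, t))
      by apply (continuous_snd (U := R_UniformSpace)).
    apply (continuous_mult (K := R_AbsRing)
             (fun p : R * R => Re (g (polar (fst p) (snd p)) * polar 1 (snd p))%C)
             (fun p : R * R => w (snd p))).
    + apply continuous_Re, continuous_Cmult.
      * apply (continuous_comp (fun p : R * R => polar (fst p) (snd p)) g).
        -- apply continuous_polar.
        -- now apply continuous_gradient, polar_in_disk.
      * apply (continuous_comp (fun p : R * R => snd p) (fun t => polar 1 t));
          auto. apply continuous_polar_r.
    + apply (continuous_comp (fun p : R * R => snd p) w); auto.
Qed.

Lemma RInt_gradient_scale (w : R -> R) (r : R) :
  (forall t, continuous w t) -> -1 < r < 1 ->
  r * RInt (fun t => Re (g (polar r t) * polar 1 t)%C * w t) (- PI) PI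
  = RInt (fun t => Re (g (polar r t) * polar r t)%C * w t) (- PI) PI.
Proof.
  intros Hw Hr. assert (HP := PI_RGT_0).
  rewrite <- (RInt_scal (fun t => Re (g (polar r t) * polar 1 t)%C * w t)).
  - apply RInt_ext. intros t _.
    change (r * (Re (g (polar r t) * polar 1 t)%C * w t)
            = Re (g (polar r t) * polar r t)%C * w t).
    rewrite (polar_scale r t) at 3. cbn. unfold Re, Im. ring.
  - apply ex_RInt_of_continuous; [lra | ]. intros t _.
    apply (continuous_mult (K := R_AbsRing)); auto.
    apply continuous_Re, continuous_Cmult.
    + apply (continuous_on_circle g); auto using continuous_gradient.
    + apply continuous_polar_r.
Qed.

(** The radial derivative of the integral, multiplied by r, is the integral of
    Re (z g(z)), which the mean value property of the holomorphic function z
    g(z) evaluates to 0. *)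
Lemma harmonic_mean_value (r : R) :
  0 <= r < 1 -> RInt (fun t => F (polar r t)) (- PI) PI = 2 * PI * F 0%C.
Proof.
  intros Hr. assert (HP := PI_RGT_0).
  rewrite (RInt_ext _ (fun t => F (polar r t) * 1))
    by (intros t _; symmetry; apply Rmult_1_r).
  rewrite (constant_of_scaled_derive
             (fun s => RInt (fun t => F (polar s t) * 1) (- PI) PI)
             (fun s => RInt (fun t => Re (g (polar s t) * polar 1 t)%C * 1)
                         (- PI) PI) r); [ | lra | | ].
  - rewrite (RInt_ext _ (fun _ => F 0%C))
      by (intros t _; rewrite polar_0; apply Rmult_1_r).
    rewrite RInt_const.
    change ((PI - - PI) * F 0%C = 2 * PI * F 0%C). ring.
  - intros s Hs. apply (derive_circle_mean (fun _ => 1)); [ | lra].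
    intros t. apply continuous_const.
  - intros s Hs. rewrite (RInt_gradient_scale (fun _ => 1));
      [ | intros t; apply continuous_const | lra].
    rewrite (RInt_ext _ (fun t => Re (g (polar s t) * polar s t)%C))
      by (intros t _; apply Rmult_1_r).
    (* Cauchy: z g(z) is holomorphic and vanishes at the centre *)
    rewrite (holo_mean_value (fun z => g z * z)%C (fun z => g' z * z + g z * 1)%C).
    + cbn. unfold Re, Im. ring.
    + intros z Hz. apply (holo_mult g (fun z => z)).
      * now apply F_harmonic.
      * apply holo_id.
    + intros z Hz.
      apply continuous_Cplus; apply continuous_Cmult.
      * now apply F_harmonic.
      * apply continuous_id.
      * now apply continuous_gradient.
      * apply continuous_const.
    + lra.
Qed.

(** With K(r) the integral, an integration by parts in the angle turns (r K)'
    = K + r K' into the integral of r Re g over the circle, which is 2 PI r Re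
    (g 0) by the mean value property. Hence r K(r) = PI r^2 Re (g 0). *)
Lemma harmonic_first_coefficient (r : R) :
  0 < r < 1 ->
  RInt (fun t => F (polar r t) * cos t) (- PI) PI = PI * r * Re (g 0%C).
Proof.
  intros Hr. assert (HP := PI_RGT_0).
  set (K := fun s => RInt (fun t => F (polar s t) * cos t) (- PI) PI).
  set (K' := fun s => RInt (fun t => Re (g (polar s t) * polar 1 t)%C * cos t)
                        (- PI) PI).
  assert (HK : forall s, -1 < s < 1 -> is_derive K s (K' s))
    by (intros s Hs; apply derive_circle_mean; auto using continuous_cos).
  assert (Hgc : forall s t, -1 < s < 1 ->
            continuous (U := C_UniformSpace)
              (fun t => (g (polar s t) * polar s t)%C) t).
  { intros s t Hs. apply continuous_Cmult.
    - apply (continuous_on_circle g); auto using continuous_gradient.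
    - apply continuous_polar_r. }
  (* integration by parts in the angle, the boundary terms carrying sin PI *)
  assert (Hparts : forall s, -1 < s < 1 ->
    is_RInt (fun t => F (polar s t) * cos t
                      - Im (g (polar s t) * polar s t)%C * sin t)
      (- PI) PI 0).
  { intros s Hs.
    replace 0 with (minus (F (polar s PI) * sin PI)
                          (F (polar s (- PI)) * sin (- PI))).
    2: { change (F (polar s PI) * sin PI - F (polar s (- PI)) * sin (- PI) = 0).
         rewrite sin_neg, sin_PI. ring. }
    apply (is_RInt_derive (fun t => F (polar s t) * sin t)).
    - intros t _.
      assert (HF : is_derive (fun t => F (polar s t)) t
                     (- Im (g (polar s t) * polar s t)%C))
        by now apply derive_circle, F_harmonic, polar_in_disk.
      replace (F (polar s t) * cos t - Im (g (polar s t) * polar s t)%C * sin t)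
        with (- Im (g (polar s t) * polar s t)%C * sin t
              + F (polar s t) * cos t) by ring.
      apply (is_derive_mult (K := R_AbsRing) (fun t => F (polar s t)) sin);
        [exact HF | apply is_derive_sin | exact Rmult_comm].
    - intros t _.
      apply (continuous_minus (fun t => F (polar s t) * cos t)
               (fun t => Im (g (polar s t) * polar s t)%C * sin t)).
      + apply (continuous_mult (K := R_AbsRing));
          auto using continuous_on_circle_F, continuous_cos.
      + apply (continuous_mult (K := R_AbsRing)
                 (fun t => Im (g (polar s t) * polar s t)%C) sin).
        * now apply continuous_Im, Hgc.
        * apply continuous_sin. }
  assert (Hode : forall s, 0 <= s <= r ->
            K s + s * K' s = 2 * PI * s * Re (g 0%C)).
  { intros s Hs. assert (Hs' : -1 < s < 1) by lra.
    unfold K'. rewrite RInt_gradient_scale by auto using continuous_cos.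
    assert (E : RInt (fun t => s * Re (g (polar s t))) (- PI) PI
                = 2 * PI * s * Re (g 0%C)).
    { rewrite (RInt_scal (fun t => Re (g (polar s t)))).
      - rewrite (holo_mean_value g g'); [ | | | lra].
        + change (s * (2 * PI * Re (g 0%C)) = 2 * PI * s * Re (g 0%C)). ring.
        + intros z Hz. now apply F_harmonic.
        + intros z Hz. now apply F_harmonic.
      - apply ex_RInt_of_continuous; [lra | ]. intros t _.
        apply continuous_Re, (continuous_on_circle g);
          auto using continuous_gradient. }
    rewrite <- E. unfold K.
    rewrite <- (RInt_plus (V := R_CompleteNormedModule)).
    2: { apply ex_RInt_of_continuous; [lra | ]. intros t _.
         apply (continuous_mult (K := R_AbsRing));
           auto using continuous_on_circle_F, continuous_cos. }
    2: { apply ex_RInt_of_continuous; [lra | ]. intros t _.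
         apply (continuous_mult (K := R_AbsRing)
                  (fun t => Re (g (polar s t) * polar s t)%C) cos).
         - now apply continuous_Re, Hgc.
         - apply continuous_cos. }
    rewrite <- (Rplus_0_r (RInt (fun t => s * _) _ _)).
    rewrite <- (is_RInt_unique _ _ _ _ (Hparts s Hs')).
    rewrite <- (RInt_plus (V := R_CompleteNormedModule)).
    - apply RInt_ext. intros t _.
      change (F (polar s t) * cos t + Re (g (polar s t) * polar s t)%C * cos t
              = s * Re (g (polar s t)) +
                (F (polar s t) * cos t
                 - Im (g (polar s t) * polar s t)%C * sin t)).
      generalize (g (polar s t)). intros (p, q). cbn.
      assert (H := sin2_cos2 t). unfold Rsqr in H.
      replace (s * p) with (s * p * (sin t * sin t + cos t * cos t))
        by (rewrite H; ring).
      ring.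
    - apply ex_RInt_of_continuous; [lra | ]. intros t _.
      apply (continuous_mult (K := R_AbsRing) (fun _ => s)
               (fun t => Re (g (polar s t)))).
      + apply continuous_const.
      + apply continuous_Re, (continuous_on_circle g);
          auto using continuous_gradient.
    - eexists. now apply Hparts. }
  set (D := fun s => s * K s - PI * s ^ 2 * Re (g 0%C)).
  assert (HD : D r = D 0).
  { apply (constant_of_scaled_derive D
             (fun s => K s + s * K' s - 2 * PI * s * Re (g 0%C))); [lra | | ].
    - intros s Hs. assert (HKs := HK s ltac:(lra)). unfold D.
      auto_derive.
      + exists (K' s). exact HKs.
      + replace (Derive (fun x => K x) s) with (K' s)
          by (symmetry; now apply is_derive_unique).
        ring.
    - intros s Hs. rewrite Hode by easy. ring. }
  unfold D in HD. fold (K r).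
  apply Rmult_eq_reg_l with r; lra.
Qed.

End Fourier.

(** * Automorphisms of the disk and the Schwarz lemma *)

(** T1 and T2 are the first two derivatives of T; the continuity of T2 is what
    keeps composites within [harmonic_with]. *)
Definition disk_map (T T1 T2 : C -> C) : Prop :=
  forall z, unit_disk z ->
    unit_disk (T z) /\ holo_at T z (T1 z) /\ holo_at T1 z (T2 z) /\
    continuous (T := C_UniformSpace) (U := C_UniformSpace) T2 z.

(** The gradient is the complex derivative of a locally defined holomorphic
    function with real part F, so it transforms by the chain rule. *)
Lemma harmonic_comp (F : C -> R) (g g' T T1 T2 : C -> C) :
  harmonic_with F g g' -> disk_map T T1 T2 ->
  harmonic_with (fun z => F (T z)) (fun z => g (T z) * T1 z)%C
    (fun z => g' (T z) * T1 z * T1 z + g (T z) * T2 z)%C.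
Proof.
  intros HF HT z Hz.
  destruct (HT z Hz) as (HTz & HT1 & HT2 & HT2c).
  destruct (HF (T z) HTz) as (Fd & gd & g'c).
  assert (Tc := holo_continuous _ _ _ HT1).
  split; [ | split].
  - apply differentiable_pt_lim_ext
      with (f1 := fun u v => F (Re (T (u, v)), Im (T (u, v)))).
    { exists (mkposreal 1 Rlt_0_1). intros u v _ _. now rewrite C_eta. }
    destruct HT1 as (HTr & HTi).
    eapply differentiable_eq.
    + apply (differentiable_pt_lim_comp (fun u v => F (u, v))
               (fun u v => Re (T (u, v))) (fun u v => Im (T (u, v))));
        [ | exact HTr | exact HTi].
      rewrite C_eta. exact Fd.
    + cbn. unfold Re, Im. ring.
    + cbn. unfold Re, Im. ring.
  - apply (holo_mult (fun w => g (T w)) T1); auto.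
    now apply (holo_comp g T).
  - apply continuous_Cplus; repeat apply continuous_Cmult; auto.
    + now apply (continuous_comp T g').
    + now apply (holo_continuous _ _ _ HT2).
    + now apply (holo_continuous _ _ _ HT2).
    + apply (continuous_comp T g); auto. now apply (holo_continuous _ _ _ gd).
Qed.

Lemma disk_map_rotation (u : C) :
  Cmod u = 1 -> disk_map (fun z => u * z)%C (fun _ => u) (fun _ => 0%C).
Proof.
  intros Hu z Hz. split; [ | split; [ | split]].
  - unfold unit_disk. now rewrite Cmod_mult, Hu, Rmult_1_l.
  - apply holo_eq with (0 * z + u * 1)%C; [ | ring].
    apply (holo_mult (fun _ => u) (fun z => z)).
    + apply holo_const.
    + apply holo_id.
  - apply holo_const.
  - apply continuous_const.
Qed.

Section Moebius.

Variable a : C.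
Hypothesis a_in_disk : unit_disk a.

Let den (z : C) : C := (1 + Cconj a * z)%C.
Let c : C := (1 - Cconj a * a)%C.

Lemma Moebius_den_neq_0 (z : C) : unit_disk z -> den z <> 0%C.
Proof.
  intros Hz H. unfold den in H.
  assert (E : (Cconj a * z)%C = (- (1))%C).
  { replace (Cconj a * z)%C with ((1 + Cconj a * z) - 1)%C by ring.
    rewrite H. ring. }
  apply (f_equal Cmod) in E.
  rewrite Cmod_mult, Cmod_opp, Cmod_1, Cmod_conj in E.
  unfold unit_disk in *.
  assert (H1 := Cmod_ge_0 a). assert (H2 := Cmod_ge_0 z). nra.
Qed.

(** The image stays in the disk because 1 - |T z|^2 = (1 - |a|^2) (1 - |z|^2)
    / |1 + conj(a) z|^2. *)
Lemma disk_map_Moebius :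
  disk_map (fun z => (z + a) * / den z)%C (fun z => c * (/ den z * / den z))%C
    (fun z => c * (- (2) * Cconj a * (/ den z * / den z * / den z)))%C.
Proof.
  intros z Hz. assert (Hden := Moebius_den_neq_0 z Hz).
  assert (Hinv : holo_at (fun z => / den z)%C z
                   (- (/ den z * / den z) * Cconj a)%C).
  { apply (holo_comp Cinv den).
    - now apply holo_inv.
    - apply holo_eq with (0 + (0 * z + Cconj a * 1))%C; [ | ring].
      apply (holo_plus (fun _ => 1%C) (fun z => Cconj a * z)%C).
      + apply holo_const.
      + apply (holo_mult (fun _ => Cconj a) (fun z => z)).
        * apply holo_const.
        * apply holo_id. }
  assert (Hcont := holo_continuous _ _ _ Hinv).
  split; [ | split; [ | split]].
  - unfold unit_disk in *.
    rewrite Cmod_mult, Cmod_inv by easy.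
    assert (Hd : 0 < Cmod (den z)) by now apply Cmod_gt_0.
    (* |1 + conj(a) z|^2 - |z + a|^2 = (1 - |a|^2) (1 - |z|^2) *)
    assert (E : Cmod (den z) ^ 2 - Cmod (z + a) ^ 2
                = (1 - Cmod a ^ 2) * (1 - Cmod z ^ 2)).
    { rewrite !Cmod2_alt. unfold den. destruct a, z.
      cbn. unfold Re, Im. cbn. ring. }
    assert (H1 := Cmod_ge_0 a). assert (H2 := Cmod_ge_0 z).
    assert (H3 := Cmod_ge_0 (z + a)%C).
    assert (Hlt : Cmod (z + a) < Cmod (den z)).
    { assert (0 < (1 - Cmod a ^ 2) * (1 - Cmod z ^ 2))
        by (apply Rmult_lt_0_compat; nra).
      nra. }
    apply Rmult_lt_reg_r with (Cmod (den z)); auto.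
    rewrite Rmult_assoc, Rinv_l by lra. lra.
  - apply holo_eq with ((1 + 0) * / den z
                        + (z + a) * (- (/ den z * / den z) * Cconj a))%C.
    + apply (holo_mult (fun z => z + a)%C (fun z => / den z)%C); auto.
      apply (holo_plus (fun z => z) (fun _ => a)).
      * apply holo_id.
      * apply holo_const.
    + unfold c. unfold den in *. field. exact Hden.
  - eapply holo_eq.
    + apply (holo_mult (fun _ => c) (fun z => / den z * / den z)%C).
      * apply holo_const.
      * apply (holo_mult (fun z => / den z)%C (fun z => / den z)%C); exact Hinv.
    + cbv beta. ring.
  - apply continuous_Cmult; [apply continuous_const | ].
    apply continuous_Cmult; [apply continuous_const | ].
    apply continuous_Cmult; [ | exact Hcont].
    now apply continuous_Cmult.
Qed.

End Moebius.

(** The rearrangement inequality applied to the first Fourier coefficient,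
    with the sine replaced by its quadratic majorant. *)
Lemma centre_gradient_bound (F : C -> R) (g g' : C -> C) (r A B : R) :
  harmonic_with F g g' -> 0 < r < 1 -> A < B ->
  (forall t, - PI <= t <= PI -> A <= F (polar r t) <= B) -> A <= F 0%C <= B ->
  PI * r * Re (g 0%C) <= 8 * ((F 0%C - A) * (B - F 0%C)) / (B - A).
Proof.
  intros HF Hr HAB Hbd H0.
  rewrite <- (harmonic_first_coefficient F g g' HF r Hr).
  apply Rle_trans with (2 * (B - A) * sin (PI * ((F 0%C - A) / (B - A)))).
  - apply (bathtub (fun t => F (polar r t))); auto.
    + intros s _. apply (continuous_on_circle_F F g g'); [easy | lra].
    + apply (harmonic_mean_value F g g'); [easy | lra].
  - set (p := (F 0%C - A) / (B - A)).
    assert (Ep : p * (B - A) = F 0%C - A) by (unfold p; field; lra).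
    assert (Hp : 0 <= p <= 1) by (split; nra).
    replace (8 * ((F 0%C - A) * (B - F 0%C)) / (B - A))
      with (2 * (B - A) * (4 * p * (1 - p))) by (unfold p; field; lra).
    apply Rmult_le_compat_l; [lra | ]. now apply sin_le_parabola.
Qed.

(** The curve gamma is the image of the circle of radius r under an
    automorphism of the disk sending 0 to a. It does not depend on A and B, so
    the range of F along it can be examined before A and B are chosen. *)
Lemma gradient_bound (F : C -> R) (g g' : C -> C) (a : C) (r : R) :
  harmonic_with F g g' -> unit_disk a -> 0 < r < 1 ->
  exists gamma : R -> C,
    (forall t, unit_disk (gamma t)) /\
    (forall t, continuous (U := C_UniformSpace) gamma t) /\
    forall A B, A < B ->
      (forall t, - PI <= t <= PI -> A <= F (gamma t) <= B) -> A <= F a <= B ->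
      PI * r * ((1 - Cmod a ^ 2) * Cmod (g a))
      <= 8 * ((F a - A) * (B - F a)) / (B - A).
Proof.
  intros HF Ha Hr.
  (* rotation turning the gradient at a into the real direction *)
  assert (Hu : exists u, Cmod u = 1 /\ (g a * u)%C = Cmod (g a)).
  { destruct (Ceq_dec (g a) 0) as [E | Hne].
    - exists 1%C. rewrite E, Cmod_0. split; [apply Cmod_1 | ring].
    - assert (Hpos : 0 < Cmod (g a)) by now apply Cmod_gt_0.
      assert (Hne' : RtoC (Cmod (g a)) <> 0%C).
      { intros E. apply RtoC_inj in E. lra. }
      exists (Cconj (g a) / Cmod (g a))%C. split.
      + rewrite Cmod_div by easy. rewrite Cmod_conj, Cmod_R, Rabs_pos_eq by lra.
        field. lra.
      + replace (g a * (Cconj (g a) / Cmod (g a)))%C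
          with ((g a * Cconj (g a)) / Cmod (g a))%C by (field; easy).
        rewrite <- Cmod2_conj, RtoC_pow. field. easy. }
  destruct Hu as (u & Hu1 & Hu2).
  assert (HM := harmonic_comp _ _ _ _ _ _
                  (harmonic_comp _ _ _ _ _ _ HF (disk_map_Moebius a Ha))
                  (disk_map_rotation u Hu1)).
  cbv beta in HM.
  assert (Hrot : forall t, unit_disk (u * polar r t)%C).
  { intros t. apply (disk_map_rotation u Hu1), polar_in_disk. lra. }
  exists (fun t => ((u * polar r t + a) * / (1 + Cconj a * (u * polar r t)))%C).
  split; [ | split].
  - intros t. now apply (disk_map_Moebius a Ha (u * polar r t)%C).
  - intros t.
    apply (continuous_comp (fun t => u * polar r t)%C
             (fun z => (z + a) * / (1 + Cconj a * z))%C).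
    + apply continuous_Cmult; [apply continuous_const | apply continuous_polar_r].
    + destruct (disk_map_Moebius a Ha _ (Hrot t)) as (_ & Hholo & _).
      exact (holo_continuous _ _ _ Hholo).
  - intros A B HAB Hbd HFa.
    assert (E0 : ((u * 0 + a) * / (1 + Cconj a * (u * 0)))%C = a)
      by field.
    assert (Hc := centre_gradient_bound _ _ _ r A B HM Hr HAB Hbd).
    cbv beta in Hc. rewrite E0 in Hc.
    apply Rle_trans with (2 := Hc HFa). right. f_equal.
    replace (1 + Cconj a * (u * 0))%C with (RtoC 1) by ring.
    replace (g a * ((1 - Cconj a * a) * (/ 1 * / 1)) * u)%C
      with ((1 - a * Cconj a) * (g a * u))%C by (field; apply C1_nz).
    rewrite Hu2, <- Cmod2_conj, <- RtoC_minus, <- RtoC_mult. now cbn.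
Qed.

(** * Real harmonic maps *)

Lemma unit_disk_locally (z : C) :
  unit_disk z -> locally_2d (fun u v => unit_disk (u, v)) (Re z) (Im z).
Proof.
  intros Hz. unfold unit_disk in *.
  assert (Hpos : 0 < (1 - Cmod z) / 2) by lra.
  exists (mkposreal _ Hpos). intros u v Hu Hv. cbn in Hu, Hv.
  replace ((u, v) : C) with (z + ((u, v) - z))%C by ring.
  apply Rle_lt_trans with (1 := Cmod_triangle _ _).
  assert (Hm := Cmod_2Rmax ((u, v) - z)%C). cbn in Hm.
  change (u + - fst z) with (u - Re z) in Hm.
  change (v + - snd z) with (v - Im z) in Hm.
  assert (Hmax : Rmax (Rabs (u - Re z)) (Rabs (v - Im z)) < (1 - Cmod z) / 2)
    by now apply Rmax_lub_lt.
  assert (H0 : 0 <= Rmax (Rabs (u - Re z)) (Rabs (v - Im z)))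
    by (apply Rle_trans with (2 := Rmax_l _ _); apply Rabs_pos).
  assert (H2 : sqrt 2 <= 2).
  { rewrite <- (sqrt_square 2) at 2 by lra. apply sqrt_le_1_alt. lra. }
  nra.
Qed.

Lemma Cn_on_le (n m : nat) (D : C -> Prop) (h : C -> R) :
  (m <= n)%nat -> Cn_on n D h -> Cn_on m D h.
Proof. intros Hmn Hh z Hz. now apply (ex_diff_n_m n m Hmn), Hh. Qed.

Lemma Cn_on_partial_u (n : nat) (D : C -> Prop) (h : C -> R) :
  Cn_on (S n) D h -> Cn_on n D (partial_u h).
Proof. intros Hh z Hz. now apply (Hh z Hz). Qed.

Lemma Cn_on_partial_v (n : nat) (D : C -> Prop) (h : C -> R) :
  Cn_on (S n) D h -> Cn_on n D (partial_v h).
Proof. intros Hh z Hz. now apply (Hh z Hz). Qed.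

Lemma Cn_on_continuous (n : nat) (D : C -> Prop) (h : C -> R) (z : C) :
  Cn_on n D h -> D z -> continuous (T := C_UniformSpace) h z.
Proof.
  intros Hh Hz.
  assert (Hc : continuity_2d_pt (fun u v => h (u, v)) (Re z) (Im z))
    by (specialize (Hh z Hz); destruct n; apply Hh).
  apply continuity_2d_pt_filterlim in Hc. rewrite C_eta in Hc.
  apply filterlim_ext with (2 := Hc). now intros (u, v).
Qed.

Lemma C1_differentiable (h : C -> R) (z : C) :
  Cn_on 1 unit_disk h -> unit_disk z ->
  differentiable_pt_lim (fun u v => h (u, v)) (Re z) (Im z)
    (partial_u h z) (partial_v h z).
Proof.
  intros Hh Hz.
  apply (differentiable_of_partials _ (fun u v => partial_u h (u, v))).
  - generalize (unit_disk_locally z Hz).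
    apply locally_2d_impl, locally_2d_forall. intros u v Huv.
    apply Derive_correct. apply (Hh (u, v) Huv).
  - apply Derive_correct. apply (Hh z Hz).
  - apply (Hh z Hz).
Qed.

Lemma C2_partials_commute (h : C -> R) (z : C) :
  Cn_on 2 unit_disk h -> unit_disk z ->
  partial_v (partial_u h) z = partial_u (partial_v h) z.
Proof.
  intros Hh Hz. symmetry.
  apply (Schwarz (fun u v => h (u, v)) (Re z) (Im z)).
  - generalize (unit_disk_locally z Hz).
    apply locally_2d_impl, locally_2d_forall. intros u v Huv.
    repeat split; apply (Hh (u, v) Huv).
  - apply (Hh z Hz).
  - apply (Hh z Hz).
Qed.

Lemma wirtinger_real (h : C -> R) (w : C) :
  wirtinger (fun z => RtoC (h z)) w = (partial_u h w / 2, - partial_v h w / 2).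
Proof.
  unfold wirtinger, Cpartial_u, Cpartial_v.
  change (partial_u (fun w' => Im (RtoC (h w'))) w) with (Derive (fun _ => 0) (Re w)).
  change (partial_v (fun w' => Im (RtoC (h w'))) w) with (Derive (fun _ => 0) (Im w)).
  change (fun w' => Re (RtoC (h w'))) with h.
  rewrite !Derive_const.
  cbv [Cdiv Cinv Cmult Cminus Cplus Copp Ci RtoC fst snd].
  f_equal; field.
Qed.

Lemma wirtinger_bar_real (h : C -> R) (w : C) :
  wirtinger_bar (fun z => RtoC (h z)) w = (partial_u h w / 2, partial_v h w / 2).
Proof.
  unfold wirtinger_bar, Cpartial_u, Cpartial_v.
  change (partial_u (fun w' => Im (RtoC (h w'))) w) with (Derive (fun _ => 0) (Re w)).
  change (partial_v (fun w' => Im (RtoC (h w'))) w) with (Derive (fun _ => 0) (Im w)).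
  change (fun w' => Re (RtoC (h w'))) with h.
  rewrite !Derive_const.
  cbv [Cdiv Cinv Cmult Cminus Cplus Copp Ci RtoC fst snd].
  f_equal; field.
Qed.

Lemma partial_u_ext (h k : C -> R) (w : C) :
  (forall z, h z = k z) -> partial_u h w = partial_u k w.
Proof. intros E. apply Derive_ext. intros t. apply E. Qed.

Lemma partial_v_ext (h k : C -> R) (w : C) :
  (forall z, h z = k z) -> partial_v h w = partial_v k w.
Proof. intros E. apply Derive_ext. intros t. apply E. Qed.

Lemma partial_u_scal (k : R) (h : C -> R) (w : C) :
  partial_u (fun z => k * h z) w = k * partial_u h w.
Proof. apply Derive_scal. Qed.

Lemma partial_v_scal (k : R) (h : C -> R) (w : C) :
  partial_v (fun z => k * h z) w = k * partial_v h w.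
Proof. apply Derive_scal. Qed.

Lemma wirtinger_bar_wirtinger_real (f : C -> R) (z : C) :
  Cn_on 2 unit_disk f -> unit_disk z ->
  wirtinger_bar (wirtinger (fun z => RtoC (f z))) z = RtoC (laplacian f z / 4).
Proof.
  intros Hf Hz. unfold wirtinger_bar, Cpartial_u, Cpartial_v, laplacian.
  assert (ERe : forall w, Re (wirtinger (fun z => RtoC (f z)) w)
                          = / 2 * partial_u f w)
    by (intros w; rewrite wirtinger_real; cbn; field).
  assert (EIm : forall w, Im (wirtinger (fun z => RtoC (f z)) w)
                          = - / 2 * partial_v f w)
    by (intros w; rewrite wirtinger_real; cbn; field).
  rewrite (partial_u_ext _ _ z ERe), (partial_v_ext _ _ z ERe).
  rewrite (partial_u_ext _ _ z EIm), (partial_v_ext _ _ z EIm).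
  rewrite !partial_u_scal, !partial_v_scal.
  rewrite (C2_partials_commute f z Hf Hz).
  cbv [Cdiv Cinv Cmult Cminus Cplus Copp Ci RtoC fst snd].
  f_equal; field.
Qed.

(** The two lines are four times the real part and minus eight times the
    imaginary part; f_z f_zbar = |grad f|^2 / 4 is real because f is. *)
Lemma real_harmonic_equation (h f : C -> R) (z : C) :
  Cn_on 2 unit_disk f -> unit_disk z ->
  (wirtinger_bar (wirtinger (fun z => RtoC (f z))) z
   + wirtinger (fun w => RtoC (h w)) (RtoC (f z))
     * wirtinger (fun z => RtoC (f z)) z
     * wirtinger_bar (fun z => RtoC (f z)) z)%C = RtoC 0
  <->
  laplacian f z + partial_u h (RtoC (f z)) / 2
                  * (partial_u f z ^ 2 + partial_v f z ^ 2) = 0 /\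
  partial_v h (RtoC (f z)) * (partial_u f z ^ 2 + partial_v f z ^ 2) = 0.
Proof.
  intros Hf Hz.
  rewrite wirtinger_bar_wirtinger_real, !wirtinger_real, wirtinger_bar_real
    by easy.
  generalize (partial_u h (RtoC (f z))), (partial_v h (RtoC (f z))),
    (partial_u f z), (partial_v f z), (laplacian f z).
  intros hu hv p q L.
  replace (RtoC (L / 4) + ((hu / 2)%R, (- hv / 2)%R)
             * ((p / 2)%R, (- q / 2)%R) * ((p / 2)%R, (q / 2)%R))%C
    with ((/ 4 * (L + hu / 2 * (p ^ 2 + q ^ 2)),
           - / 8 * (hv * (p ^ 2 + q ^ 2))) : C)
    by (unfold RtoC, Cplus, Cmult; cbn [fst snd]; f_equal; field).
  split.
  - intros E. injection E as E1 E2. lra.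
  - intros (E1 & E2). rewrite E1, E2. unfold RtoC. f_equal; ring.
Qed.

Lemma real_harmonic_strip (Omega : C -> Prop) (varrho f : C -> R) :
  onto_interval f -> real_harmonic Omega varrho f ->
  real_harmonic strip (strip_density varrho) f.
Proof.
  intros Honto (HO & Hf & H0 & Heq).
  split; [ | split; [exact Hf | split; [exact H0 | ]]].
  - intros z Hz. apply (Honto (f z)). now exists z.
  - intros z Hz.
    apply (real_harmonic_equation (fun w => ln (strip_density varrho w ^ 2)));
      auto.
    destruct (proj1 (real_harmonic_equation (fun w => ln (varrho w ^ 2)) f z Hf Hz)
                    (Heq z Hz)) as (E & _).
    split; [exact E | ].
    change (partial_v (fun w => ln (strip_density varrho w ^ 2)) (RtoC (f z)))
      with (Derive (fun _ => ln (varrho (f z, 0) ^ 2)) 0).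
    rewrite Derive_const. ring.
Qed.

(** * The linearizing primitive and the gradient estimate *)

Lemma differentiable_comp_1 (k : R -> R) (h : R -> R -> R) (x y k' hx hy : R) :
  is_derive k (h x y) k' -> differentiable_pt_lim h x y hx hy ->
  differentiable_pt_lim (fun u v => k (h u v)) x y (k' * hx) (k' * hy).
Proof.
  intros Hk Hh.
  replace (k' * hx) with (k' * hx + 0 * hx) by ring.
  replace (k' * hy) with (k' * hy + 0 * hy) by ring.
  apply (differentiable_pt_lim_comp (fun s _ => k s) h h); auto.
  apply differentiable_pt_lim_proj1_0. now apply is_derive_Reals.
Qed.

(** Of the Cauchy-Riemann equations of rho(f) (f_x - i f_y), one is the
    symmetry of second derivatives, the other is rho(f) times the equation of
    f. *)
Lemma linearization (rho rho' G : R -> R) (f : C -> R) :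
  (forall t, -1 < t < 1 -> is_derive G t (rho t)) ->
  (forall t, -1 < t < 1 -> is_derive rho t (rho' t)) ->
  (forall t, -1 < t < 1 -> continuous rho' t) ->
  (forall t, -1 < t < 1 -> 0 < rho t) ->
  Cn_on 2 unit_disk f ->
  (forall z, unit_disk z -> -1 < f z < 1) ->
  (forall z, unit_disk z ->
     laplacian f z
     + rho' (f z) / rho (f z) * (partial_u f z ^ 2 + partial_v f z ^ 2) = 0) ->
  harmonic_with (fun z => G (f z))
    (fun z => (rho (f z) * partial_u f z, - (rho (f z) * partial_v f z)))
    (fun z => (partial_u f z * (rho' (f z) * partial_u f z)
               + rho (f z) * partial_u (partial_u f) z,
               - (partial_u f z * (rho' (f z) * partial_v f z)
                  + rho (f z) * partial_v (partial_u f) z))).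
Proof.
  intros HG Hrho Hrho' Hpos Hf Hint Heq z Hz.
  assert (Hfz := Hint z Hz).
  assert (Hf1 : Cn_on 1 unit_disk f) by (apply Cn_on_le with 2%nat; auto).
  assert (HP := Cn_on_partial_u 1 _ _ Hf).
  assert (HQ := Cn_on_partial_v 1 _ _ Hf).
  assert (Df := C1_differentiable f z Hf1 Hz).
  assert (DP := C1_differentiable _ z HP Hz).
  assert (DQ := C1_differentiable _ z HQ Hz).
  assert (Drho : differentiable_pt_lim (fun u v => rho (f (u, v))) (Re z) (Im z)
                   (rho' (f z) * partial_u f z) (rho' (f z) * partial_v f z)).
  { apply (differentiable_comp_1 rho (fun u v => f (u, v))); auto.
    rewrite C_eta. auto. }
  assert (DrP := differentiable_mult _ _ _ _ _ _ _ _ Drho DP).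
  assert (DrQ := differentiable_opp _ _ _ _ _
                   (differentiable_mult _ _ _ _ _ _ _ _ Drho DQ)).
  cbv beta in DrP, DrQ. rewrite C_eta in DrP, DrQ.
  split; [ | split; [split | ]].
  - eapply differentiable_eq.
    + apply (differentiable_comp_1 G (fun u v => f (u, v))).
      * rewrite C_eta. now apply HG.
      * exact Df.
    + cbn. ring.
    + cbn. ring.
  - eapply differentiable_eq; [exact DrP | | ]; cbn; ring.
  - (* closedness of d(G o f), then the equation of f *)
    eapply differentiable_eq; [exact DrQ | | ]; cbn.
    + rewrite (C2_partials_commute f z Hf Hz). ring.
    + specialize (Heq z Hz). unfold laplacian in Heq. specialize (Hpos _ Hfz).
      apply (f_equal (Rmult (rho (f z)))) in Heq.
      rewrite Rmult_0_r, Rmult_plus_distr_l in Heq.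
      replace (rho (f z) * (rho' (f z) / rho (f z)
                 * (partial_u f z ^ 2 + partial_v f z ^ 2)))
        with (rho' (f z) * (partial_u f z ^ 2 + partial_v f z ^ 2))
        in Heq by (field; lra).
      lra.
  - assert (Cf : continuous (T := C_UniformSpace) f z)
      by now apply (Cn_on_continuous 1 unit_disk).
    assert (Crho : continuous (T := C_UniformSpace) (fun z => rho (f z)) z).
    { apply (continuous_comp f rho); auto.
      apply (ex_derive_continuous rho). eexists. now apply Hrho. }
    assert (Crho' : continuous (T := C_UniformSpace) (fun z => rho' (f z)) z)
      by (apply (continuous_comp f rho'); auto).
    assert (CP := Cn_on_continuous _ _ _ z HP Hz).
    assert (CQ := Cn_on_continuous _ _ _ z HQ Hz).
    assert (CPu := Cn_on_continuous _ _ _ z (Cn_on_partial_u 0 _ _ HP) Hz).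
    assert (CPv := Cn_on_continuous _ _ _ z (Cn_on_partial_v 0 _ _ HP) Hz).
    assert (Cterm : forall a b, continuous (T := C_UniformSpace) a z ->
              continuous (T := C_UniformSpace) b z ->
              continuous (T := C_UniformSpace)
                (fun z => partial_u f z * (rho' (f z) * a z) + rho (f z) * b z) z).
    { intros a b Ha Hb.
      apply (continuous_plus (V := R_NormedModule) (U := C_UniformSpace)
               (fun z => partial_u f z * (rho' (f z) * a z))
               (fun z => rho (f z) * b z)).
      - apply (continuous_mult (K := R_AbsRing) (partial_u f)); auto.
        now apply (continuous_mult (K := R_AbsRing) (fun z => rho' (f z))).
      - now apply (continuous_mult (K := R_AbsRing) (fun z => rho (f z))). }
    apply (continuous_to_C (U := C_UniformSpace)); cbn [Re Im fst snd].
    + now apply Cterm.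
    + apply (continuous_opp (V := R_NormedModule) (U := C_UniformSpace)).
      now apply Cterm.
Qed.

Lemma primitive_on_interval (rho : R -> R) :
  (forall t, -1 < t < 1 -> continuous rho t) ->
  forall t, -1 < t < 1 -> is_derive (fun s => RInt rho 0 s) t (rho t).
Proof.
  intros Hc t Ht.
  apply (is_derive_RInt rho _ 0); auto.
  assert (Hpos : 0 < Rmin (t + 1) (1 - t)) by (apply Rmin_pos; lra).
  exists (mkposreal _ Hpos). intros s Hs.
  apply (RInt_correct (V := R_CompleteNormedModule)).
  apply (ex_RInt_continuous (V := R_CompleteNormedModule)).
  intros x Hx. apply Hc.
  change (Rabs (s - t) < Rmin (t + 1) (1 - t)) in Hs. apply Rabs_def2 in Hs.
  assert (H1 := Rmin_l (t + 1) (1 - t)). assert (H2 := Rmin_r (t + 1) (1 - t)).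
  revert Hx. unfold Rmin, Rmax in *. destruct (Rle_dec 0 s); lra.
Qed.

(** By compactness |f| attains a maximum below 1 along the curve; m is taken
    strictly between this maximum, or |s| if that is larger, and 1. *)
Lemma circle_values_bound (f : C -> R) (gamma : R -> C) (s : R) :
  (forall z, unit_disk z -> continuous (T := C_UniformSpace) f z) ->
  (forall z, unit_disk z -> -1 < f z < 1) -> -1 < s < 1 ->
  (forall t, unit_disk (gamma t)) ->
  (forall t, continuous (U := C_UniformSpace) gamma t) ->
  exists m, 0 < m < 1 /\ - m < s < m /\
    forall t, - PI <= t <= PI -> - m < f (gamma t) < m.
Proof.
  intros Hf Hint Hs Hg Hgc. assert (HP := PI_RGT_0).
  set (k := fun t => Rabs (f (gamma t))).
  assert (Hk : forall t, - PI <= t <= PI -> continuity_pt k t).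
  { intros t _. apply continuity_pt_filterlim.
    apply (continuous_comp (fun t => f (gamma t)) Rabs).
    - apply (continuous_comp gamma f); auto.
    - apply continuous_Rabs. }
  destruct (continuity_ab_maj k (- PI) PI ltac:(lra) Hk) as (t0 & Hmax & _).
  assert (H0 : k t0 < 1) by (apply Rabs_def1; apply Hint, Hg).
  assert (Hs1 : Rabs s < 1) by now apply Rabs_def1.
  assert (Hm : Rmax (k t0) (Rabs s) < 1) by now apply Rmax_lub_lt.
  assert (Hl := Rmax_l (k t0) (Rabs s)). assert (Hr := Rmax_r (k t0) (Rabs s)).
  assert (Hs0 := Rabs_pos s).
  exists ((Rmax (k t0) (Rabs s) + 1) / 2). split; [lra | split].
  - assert (H : Rabs s < (Rmax (k t0) (Rabs s) + 1) / 2) by lra.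
    apply Rabs_def2 in H. lra.
  - intros t Ht. specialize (Hmax t Ht).
    assert (H : k t < (Rmax (k t0) (Rabs s) + 1) / 2) by lra.
    unfold k in H at 1. apply Rabs_def2 in H. lra.
Qed.

Lemma Cmod_scaled_gradient (c p q : R) :
  0 <= c -> Cmod ((c * p, - (c * q)) : C) = c * sqrt (p ^ 2 + q ^ 2).
Proof.
  intros Hc. unfold Cmod. cbn [fst snd].
  replace ((c * p) ^ 2 + (- (c * q)) ^ 2) with (c ^ 2 * (p ^ 2 + q ^ 2)) by ring.
  rewrite sqrt_mult by nra. now rewrite sqrt_pow2.
Qed.

(** The function m - t^2 / m increases with m. *)
Lemma chord_bound (m t : R) :
  0 < m < 1 -> - m < t < m -> (t + m) * (m - t) / m <= 1 - t ^ 2.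
Proof.
  intros Hm Ht. apply Rmult_le_reg_r with m; [lra | ].
  replace ((t + m) * (m - t) / m * m) with (m ^ 2 - t ^ 2) by (field; lra).
  nra.
Qed.

(** The masses M and N of the two sides of f z in [-m, m] are the distances of
    F z to the ends of the range of F on the curve, so that the isoperimetric
    inequality cancels the bound of the Schwarz lemma exactly, up to the
    factor rho (f z). *)
Lemma log_concave_gradient_estimate (rho rho' l' : R -> R) (f : C -> R) :
  (forall t, -1 < t < 1 -> 0 < rho t) ->
  (forall t, -1 < t < 1 -> is_derive rho t (rho' t)) ->
  (forall t, -1 < t < 1 -> continuous rho' t) ->
  (forall t, -1 < t < 1 -> is_derive (fun s => rho' s / rho s) t (l' t)) ->
  (forall t, -1 < t < 1 -> l' t <= 0) ->
  Cn_on 2 unit_disk f ->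
  (forall z, unit_disk z -> -1 < f z < 1) ->
  (forall z, unit_disk z ->
     laplacian f z
     + rho' (f z) / rho (f z) * (partial_u f z ^ 2 + partial_v f z ^ 2) = 0) ->
  forall z, unit_disk z ->
    (1 - Cmod z ^ 2) * grad_norm f z <= 4 / PI * (1 - f z ^ 2).
Proof.
  intros Hpos Hrho Hrho' Hl Hl' Hf Hint Heq z Hz.
  assert (HP := PI_RGT_0).
  set (G := fun s => RInt rho 0 s).
  assert (HG : forall t, -1 < t < 1 -> is_derive G t (rho t)).
  { apply primitive_on_interval. intros t Ht.
    apply (ex_derive_continuous rho). eexists. now apply Hrho. }
  assert (Hln : forall t, -1 < t < 1 ->
                  is_derive (fun s => ln (rho s)) t (rho' t / rho t)).
  { intros t Ht. apply (is_derive_comp ln rho); [ | now apply Hrho].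
    now apply is_derive_ln, Hpos. }
  assert (Hharm := linearization rho rho' G f HG Hrho Hrho' Hpos Hf Hint Heq).
  assert (Hft := Hint z Hz). set (t := f z) in *.
  assert (Hr : forall r, 0 < r < 1 ->
            r * ((1 - Cmod z ^ 2) * grad_norm f z) <= 4 / PI * (1 - t ^ 2)).
  { intros r Hr.
    destruct (gradient_bound _ _ _ z r Hharm Hz Hr)
      as (gamma & Hg & Hgc & Hbound).
    destruct (circle_values_bound f gamma t) as (m & Hm & Htm & Hvals); auto.
    { intros w Hw. now apply (Cn_on_continuous 2 unit_disk). }
    assert (Hinc : forall x y, - m <= x -> x < y -> y <= m -> G x < G y).
    { apply (primitive_increasing rho G (- m) m);
        intros s Hs; [apply Hpos | apply HG]; lra. }
    assert (HA : G (- m) < G t) by (apply Hinc; lra).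
    assert (HB : G t < G m) by (apply Hinc; lra).
    assert (Hb := Hbound (G (- m)) (G m) ltac:(lra)). cbv beta in Hb.
    fold t in Hb. rewrite Cmod_scaled_gradient in Hb
      by (left; now apply Hpos).
    fold (grad_norm f z) in Hb.
    assert (Hiso : 2 * m * ((G t - G (- m)) * (G m - G t))
                   <= rho t * ((t + m) * (m - t)) * (G m - G (- m))).
    { replace (2 * m) with (m - - m) by ring.
      replace (t + m) with (t - - m) by ring.
      apply (log_concave_isoperimetry rho G (fun s => rho' s / rho s) l');
        try lra; intros s Hs;
        [apply Hpos | apply HG | apply Hln | apply Hl | apply Hl']; lra. }
    assert (Hrt := Hpos t Hft).
    assert (H1 : PI * r * ((1 - Cmod z ^ 2) * (rho t * grad_norm f z))
                 <= 4 * rho t * ((t + m) * (m - t) / m)).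
    { apply Rle_trans
        with (8 * ((G t - G (- m)) * (G m - G t)) / (G m - G (- m))).
      - apply Hb; [ | lra].
        intros s Hs. specialize (Hvals s Hs).
        split; left; apply Hinc; lra.
      - apply Rmult_le_reg_r with (m * (G m - G (- m)));
          [apply Rmult_lt_0_compat; lra | ].
        replace (8 * ((G t - G (- m)) * (G m - G t)) / (G m - G (- m))
                 * (m * (G m - G (- m))))
          with (4 * (2 * m * ((G t - G (- m)) * (G m - G t)))) by (field; lra).
        replace (4 * rho t * ((t + m) * (m - t) / m) * (m * (G m - G (- m))))
          with (4 * (rho t * ((t + m) * (m - t)) * (G m - G (- m))))
          by (field; lra).
        lra. }
    assert (H2 := chord_bound m t Hm Htm).
    apply Rmult_le_reg_l with (PI * rho t); [now apply Rmult_lt_0_compat | ].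
    replace (PI * rho t * (4 / PI * (1 - t ^ 2)))
      with (4 * rho t * (1 - t ^ 2)) by (field; lra).
    apply Rle_trans with (4 * rho t * ((t + m) * (m - t) / m)).
    - apply Rle_trans with (2 := H1). right. ring.
    - apply Rmult_le_compat_l; lra. }
  set (X := (1 - Cmod z ^ 2) * grad_norm f z) in *.
  set (Y := 4 / PI * (1 - t ^ 2)) in *.
  assert (HY : 0 < Y).
  { unfold Y. apply Rmult_lt_0_compat; [ | nra].
    apply Rdiv_lt_0_compat; lra. }
  apply Rnot_lt_le. intros HXY.
  assert (Hq : 0 < Y / X < 1).
  { split.
    - apply Rdiv_lt_0_compat; lra.
    - apply Rmult_lt_reg_r with X; [lra | ].
      replace (Y / X * X) with Y by (field; lra). lra. }
  specialize (Hr ((1 + Y / X) / 2) ltac:(lra)).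
  replace ((1 + Y / X) / 2 * X) with ((X + Y) / 2) in Hr by (field; lra).
  lra.
Qed.

Lemma grad_norm_bound_div (f : C -> R) (z : C) :
  -1 < f z < 1 ->
  (1 - Cmod z ^ 2) * grad_norm f z <= 4 / PI * (1 - f z ^ 2) ->
  grad_norm f z * ((1 - Cmod z ^ 2) / (1 - Rabs (f z) ^ 2)) <= 4 / PI.
Proof.
  intros Hf H. rewrite pow2_abs.
  assert (Hpos : 0 < 1 - f z ^ 2) by nra.
  apply Rmult_le_reg_r with (1 - f z ^ 2); auto.
  replace (grad_norm f z * ((1 - Cmod z ^ 2) / (1 - f z ^ 2)) * (1 - f z ^ 2))
    with ((1 - Cmod z ^ 2) * grad_norm f z) by (field; lra).
  exact H.
Qed.

Lemma near_in_interval (t : R) :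
  -1 < t < 1 -> locally t (fun s => -1 < s < 1).
Proof.
  intros Ht. apply (open_and (fun s => -1 < s) (fun s => s < 1)); auto.
  - apply open_gt.
  - apply open_lt.
Qed.

(** Since log rho does not vary with v, the curvature has the sign of - (log
    rho)''; and half the u-derivative of log rho^2, which is what the harmonic
    map equation contains, is rho'/rho. *)
Lemma strip_gradient_estimate (Omega : C -> Prop) (varrho f : C -> R) :
  setting Omega varrho f ->
  (forall w, strip w -> 0 <= curvature (strip_density varrho) w) ->
  forall z, unit_disk z ->
    grad_norm f z * ((1 - Cmod z ^ 2) / (1 - Rabs (f z) ^ 2)) <= 4 / PI.
Proof.
  intros (_ & _ & HI & (Hsm & Hpos) & Hharm & Honto) Hcurv z Hz.
  assert (Hint : forall z, unit_disk z -> -1 < f z < 1).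
  { intros w Hw. apply (Honto (f w)). now exists w. }
  set (rho := fun t => varrho (t, 0)).
  assert (rho_pos : forall t, -1 < t < 1 -> 0 < rho t)
    by (intros t Ht; now apply Hpos, (HI t)).
  assert (rho_C2 : forall t, -1 < t < 1 ->
            ex_derive rho t /\ ex_derive (Derive rho) t).
  { intros t Ht. assert (H := Hsm 2%nat (RtoC t) (HI t Ht)).
    split; apply H. }
  set (rho' := Derive rho). set (l := fun t => rho' t / rho t).
  assert (Hrho : forall t, -1 < t < 1 -> is_derive rho t (rho' t))
    by (intros t Ht; now apply Derive_correct, rho_C2).
  assert (Hl : forall t, -1 < t < 1 -> is_derive l t (Derive l t)).
  { intros t Ht. apply Derive_correct. unfold l.
    apply (ex_derive_div rho' rho).
    - now apply rho_C2.
    - now apply rho_C2.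
    - specialize (rho_pos t Ht). lra. }
  assert (Hdln : forall t, -1 < t < 1 -> Derive (fun s => ln (rho s)) t = l t).
  { intros t Ht. apply is_derive_unique.
    apply (is_derive_comp ln rho); [ | now apply Hrho].
    now apply is_derive_ln, rho_pos. }
  apply grad_norm_bound_div; auto.
  apply (log_concave_gradient_estimate rho rho' (Derive l)); auto.
  - intros t Ht. apply (ex_derive_continuous rho'). now apply rho_C2.
  - intros t Ht. specialize (Hcurv (RtoC t) Ht). unfold curvature in Hcurv.
    assert (E : laplacian (fun w => ln (strip_density varrho w)) (RtoC t)
                = Derive l t).
    { unfold laplacian.
      change (partial_u (partial_u (fun w => ln (strip_density varrho w))) (RtoC t))
        with (Derive (fun u => Derive (fun s => ln (rho s)) u) t).
      rewrite (Derive_ext_loc _ l).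
      - rewrite (partial_v_ext _ (fun _ => 0)).
        + unfold partial_v. rewrite Derive_const. ring.
        + intros w.
          change (Derive (fun _ => ln (rho (Re w))) (Im w) = 0).
          apply Derive_const.
      - apply filter_imp with (2 := near_in_interval t Ht). exact Hdln. }
    rewrite E in Hcurv. change (strip_density varrho (RtoC t)) with (rho t) in Hcurv.
    assert (Hr := rho_pos t Ht).
    assert (Hr2 : 0 < rho t ^ 2) by now apply pow_lt.
    apply Rnot_lt_le. intros Hlt.
    assert (0 < Derive l t / rho t ^ 2) by now apply Rdiv_lt_0_compat.
    lra.
  - now apply Hharm.
  - intros w Hw.
    destruct Hharm as (_ & Hf & _ & Heq).
    destruct (proj1 (real_harmonic_equation (fun w => ln (varrho w ^ 2)) f w Hf Hw)
                (Heq w Hw)) as (E & _).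
    replace (rho' (f w) / rho (f w))
      with (partial_u (fun w => ln (varrho w ^ 2)) (RtoC (f w)) / 2); [exact E | ].
    change (Derive (fun u => ln (rho u ^ 2)) (f w) / 2
            = rho' (f w) / rho (f w)).
    assert (Hfw := Hint w Hw).
    rewrite (Derive_ext_loc _ (fun u => 2 * ln (rho u))).
    + rewrite Derive_scal, Hdln by easy. unfold l. field.
      specialize (rho_pos _ Hfw). lra.
    + apply filter_imp with (2 := near_in_interval _ Hfw).
      intros s Hs. cbn. rewrite Rmult_1_r, ln_mult by auto. ring.
Qed.

(** * Sharpness *)

Lemma harmonic_with_partials (F : C -> R) (g g' : C -> C) (z : C) :
  harmonic_with F g g' -> unit_disk z ->
  partial_u F z = Re (g z) /\ partial_v F z = - Im (g z).
Proof.
  intros HF Hz. exact (differentiable_pt_lim_unique _ _ _ _ _ (proj1 (HF z Hz))).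
Qed.

Lemma Cn_on_step (n : nat) (h p q : C -> R) :
  Cn_on n unit_disk p -> Cn_on n unit_disk q ->
  (forall z, unit_disk z ->
     differentiable_pt_lim (fun u v => h (u, v)) (Re z) (Im z) (p z) (q z)) ->
  Cn_on (S n) unit_disk h.
Proof.
  intros Hp Hq Hd z Hz.
  assert (Hu := fun w Hw => differentiable_pt_lim_unique _ _ _ _ _ (Hd w Hw)).
  assert (Hloc := unit_disk_locally z Hz).
  split; [ | split; [ | split; [ | split]]].
  - apply differentiable_continuity_pt. eexists. eexists. now apply Hd.
  - exists (p z).
    replace (p z) with (p z * 1 + q z * 0) by ring.
    apply (derive_along h (fun s => s) (fun _ => Im z)); auto.
    + apply (is_derive_id (K := R_AbsRing)).
    + apply (is_derive_const (K := R_AbsRing) (V := R_NormedModule)).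
  - exists (q z).
    replace (q z) with (p z * 0 + q z * 1) by ring.
    apply (derive_along h (fun _ => Re z) (fun s => s)); auto.
    + apply (is_derive_const (K := R_AbsRing) (V := R_NormedModule)).
    + apply (is_derive_id (K := R_AbsRing)).
  - apply ex_diff_n_ext_loc with (2 := Hp z Hz).
    revert Hloc. apply locally_2d_impl, locally_2d_forall.
    intros u v Huv. symmetry. apply (Hu (u, v) Huv).
  - apply ex_diff_n_ext_loc with (2 := Hq z Hz).
    revert Hloc. apply locally_2d_impl, locally_2d_forall.
    intros u v Huv. symmetry. apply (Hu (u, v) Huv).
Qed.

Lemma C0_of_continuous (h : C -> R) :
  (forall z, unit_disk z -> continuous (T := C_UniformSpace) h z) ->
  Cn_on 0 unit_disk h.
Proof.
  intros Hh (x, y) Hz. split; [ | easy].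
  apply continuity_2d_pt_filterlim.
  apply filterlim_ext with (2 := Hh (x, y) Hz). now intros (u, v).
Qed.

(** The partial derivatives of F are the components of g, and those of g are
    the components of g'. *)
Lemma harmonic_with_C2 (F : C -> R) (g g' : C -> C) :
  harmonic_with F g g' -> Cn_on 2 unit_disk F.
Proof.
  intros HF.
  assert (Hre : forall z, unit_disk z ->
            continuous (T := C_UniformSpace) (fun w => Re (g' w)) z)
    by (intros z Hz; apply (continuous_Re (U := C_UniformSpace)), HF, Hz).
  assert (Him : forall z, unit_disk z ->
            continuous (T := C_UniformSpace) (fun w => Im (g' w)) z)
    by (intros z Hz; apply (continuous_Im (U := C_UniformSpace)), HF, Hz).
  assert (Hopp : forall h, (forall z, unit_disk z ->
              continuous (T := C_UniformSpace) h z) ->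
            Cn_on 0 unit_disk (fun w => - h w)).
  { intros h Hh. apply C0_of_continuous. intros z Hz.
    now apply (continuous_opp (V := R_NormedModule) (U := C_UniformSpace)), Hh. }
  apply (Cn_on_step 1 F (fun z => Re (g z)) (fun z => - Im (g z))).
  - apply (Cn_on_step 0 _ (fun z => Re (g' z)) (fun z => - Im (g' z))); auto.
    + now apply C0_of_continuous.
    + intros z Hz. apply (HF z Hz).
  - apply (Cn_on_step 0 _ (fun z => - Im (g' z)) (fun z => - Re (g' z))); auto.
    intros z Hz.
    apply (differentiable_opp (fun u v => Im (g (u, v)))). apply (HF z Hz).
  - intros z Hz. apply (HF z Hz).
Qed.

Lemma harmonic_with_laplacian (F : C -> R) (g g' : C -> C) (z : C) :
  harmonic_with F g g' -> unit_disk z -> laplacian F z = 0.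
Proof.
  intros HF Hz. unfold laplacian.
  assert (Hloc := unit_disk_locally z Hz).
  destruct (HF z Hz) as (_ & (H1 & H2) & _).
  apply differentiable_pt_lim_unique in H1, H2.
  replace (partial_u (partial_u F) z) with (Re (g' z)).
  - replace (partial_v (partial_v F) z) with (- Re (g' z)); [ring | ].
    rewrite <- (proj2 H2), <- Derive_opp. symmetry. apply Derive_ext_loc.
    apply locally_2d_1d_const_x in Hloc.
    apply filter_imp with (2 := Hloc). intros v Hv.
    now apply (harmonic_with_partials F g g' (Re z, v)).
  - rewrite <- (proj1 H1). symmetry. apply Derive_ext_loc.
    apply locally_2d_1d_const_y in Hloc.
    apply filter_imp with (2 := Hloc). intros u Hu.
    now apply (harmonic_with_partials F g g' (u, Im z)).
Qed.

(** Along the segment joining a point of U to a point of V the indicator of V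
    would be locally constant, hence constant by the mean value theorem. *)
Lemma connected_plane : connected_set (fun _ => True).
Proof.
  intros U V HU HV Hcover (a & _ & Ha) (b & _ & Hb).
  apply NNPP. intros Hdisj.
  assert (Hno : forall w, U w -> V w -> False)
    by (intros w H1 H2; apply Hdisj; now exists w).
  set (path := fun t : R => (Re a + t * (Re b - Re a),
                             Im a + t * (Im b - Im a)) : C).
  assert (Hpath : forall t, continuous (U := C_UniformSpace) path t).
  { intros t. apply continuous_to_C; cbn;
      apply (ex_derive_continuous (K := R_AbsRing) (V := R_NormedModule));
      auto_derive; auto. }
  set (chi := fun t => if excluded_middle_informative (V (path t))
                       then 1 else 0).
  assert (Hchi : forall t, is_derive chi t 0).
  { intros t.
    apply (is_derive_ext_loc (fun _ => chi t));
      [ | apply (is_derive_const (K := R_AbsRing) (V := R_NormedModule))].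
    unfold chi at 1.
    destruct (excluded_middle_informative (V (path t))) as [Hv | Hv].
    - assert (Hl : locally t (fun s => V (path s))) by exact (Hpath t _ (HV _ Hv)).
      revert Hl. apply filter_imp. intros s Hs.
      unfold chi. now destruct (excluded_middle_informative (V (path s))).
    - assert (Hu : U (path t)) by (destruct (Hcover (path t) I); easy).
      assert (Hl : locally t (fun s => U (path s))) by exact (Hpath t _ (HU _ Hu)).
      revert Hl. apply filter_imp. intros s Hs.
      unfold chi. destruct (excluded_middle_informative (V (path s))); [ | easy].
      exfalso. now apply (Hno (path s)). }
  assert (E : chi 0 = chi 1)
    by (apply (eq_is_derive chi 0 1); [intros t _; apply Hchi | lra]).
  unfold chi in E.
  replace (path 0) with a in E
    by (unfold path; destruct a; cbn; f_equal; ring).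
  replace (path 1) with b in E
    by (unfold path; destruct a, b; cbn; f_equal; ring).
  destruct (excluded_middle_informative (V a)) as [Hva | _].
  - now apply (Hno a).
  - destruct (excluded_middle_informative (V b)); [lra | easy].
Qed.

Lemma Cn_on_const (n : nat) (D : C -> Prop) (c : R) : Cn_on n D (fun _ => c).
Proof.
  intros z _. generalize (Re z), (Im z). intros x y. revert c.
  induction n as [ | n IH]; intros c.
  - split; [apply continuity_2d_pt_const | easy].
  - split; [apply continuity_2d_pt_const | ].
    split; [apply ex_derive_const | ]. split; [apply ex_derive_const | ].
    split; apply ex_diff_n_ext_loc with (2 := IH 0), locally_2d_forall;
      intros u v; symmetry; apply Derive_const.
Qed.

(** The real part of (4/PI) arctan z, in the form that is defined on the whole
    disk: the argument of (1 + i z) / (1 - i z) has tangent 2 x / (1 -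
    |z|^2). *)
Definition extremal (z : C) : R :=
  2 / PI * atan (2 * Re z / (1 - Re z ^ 2 - Im z ^ 2)).

(** The complex derivative of (4/PI) arctan z. *)
Definition extremal_grad (z : C) : C := (RtoC (4 / PI) * / (1 + z * z))%C.

Lemma unit_disk_norm2 (z : C) : unit_disk z <-> Re z ^ 2 + Im z ^ 2 < 1.
Proof.
  unfold unit_disk. rewrite <- Cmod2_alt. assert (H := Cmod_ge_0 z).
  split; intros H1; nra.
Qed.

Lemma extremal_den_neq_0 (z : C) : unit_disk z -> (1 + z * z)%C <> 0%C.
Proof.
  intros Hz E. apply unit_disk_norm2 in Hz. destruct z as (x, y).
  cbn in Hz. unfold RtoC, Cplus, Cmult in E. cbn in E. injection E as E1 E2.
  nra.
Qed.

Lemma extremal_harmonic :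
  harmonic_with extremal extremal_grad
    (fun z => RtoC (4 / PI) * (- (2) * z * (/ (1 + z * z) * / (1 + z * z))))%C.
Proof.
  intros z Hz. assert (HP := PI_RGT_0).
  assert (Hden := extremal_den_neq_0 z Hz).
  assert (Hden' : holo_at (fun z => 1 + z * z)%C z (2 * z)%C).
  { eapply holo_eq.
    - apply (holo_plus (fun _ => 1%C) (fun z => z * z)%C).
      + apply holo_const.
      + apply (holo_mult (fun z => z) (fun z => z)); apply holo_id.
    - ring. }
  assert (Hinv : holo_at (fun z => / (1 + z * z))%C z
                   (- (/ (1 + z * z) * / (1 + z * z)) * (2 * z))%C)
    by (apply (holo_comp Cinv); [now apply holo_inv | easy]).
  assert (Hcont := holo_continuous _ _ _ Hinv).
  split; [ | split].
  - apply unit_disk_norm2 in Hz. destruct z as (x, y). cbn [Re Im fst snd] in Hz.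
    assert (Hd : differentiable_pt_lim
                   (fun u v => 2 * u * / (1 - u ^ 2 - v ^ 2)) x y
                   (2 * (1 + x ^ 2 - y ^ 2) / (1 - x ^ 2 - y ^ 2) ^ 2)
                   (4 * x * y / (1 - x ^ 2 - y ^ 2) ^ 2)).
    { assert (D1 : differentiable_pt_lim (fun u v => 1 - u ^ 2 - v ^ 2) x y
                     (- (2 * x)) (- (2 * y))).
      { apply (differentiable_of_partials _ (fun u v => - (2 * u))).
        - apply locally_2d_forall. intros u v. auto_derive; [easy | ring].
        - auto_derive; [easy | ring].
        - apply continuity_2d_pt_opp, continuity_2d_pt_mult;
            [apply continuity_2d_pt_const | apply continuity_2d_pt_id1]. }
      assert (HI : is_derive (fun s => / s) (1 - x ^ 2 - y ^ 2)
                     (- / (1 - x ^ 2 - y ^ 2) ^ 2))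
        by (auto_derive; [lra | field; lra]).
      assert (D2 := differentiable_comp_1 Rinv (fun u v => 1 - u ^ 2 - v ^ 2)
                      _ _ _ _ _ HI D1).
      assert (D3 : differentiable_pt_lim (fun u v => 2 * u) x y 2 0).
      { apply (differentiable_pt_lim_proj1_0 (fun u => 2 * u)).
        apply is_derive_Reals. auto_derive; [easy | ring]. }
      eapply differentiable_eq.
      - exact (differentiable_mult _ _ _ _ _ _ _ _ D3 D2).
      - cbv beta. field. lra.
      - cbv beta. field. lra. }
    assert (Ha : is_derive (fun s => 2 / PI * atan s)
                   (2 * x * / (1 - x ^ 2 - y ^ 2))
                   (2 / PI / (1 + (2 * x * / (1 - x ^ 2 - y ^ 2)) ^ 2))).
    { apply (is_derive_scal atan). apply is_derive_Reals.
      rewrite <- Rsqr_pow2. apply derivable_pt_lim_atan. }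
    assert (HW : 0 < (1 - x ^ 2 - y ^ 2) ^ 2 + (2 * x) ^ 2) by nra.
    assert (HW' : (1 + (x * x - y * y)) ^ 2 + (x * y + y * x) ^ 2 <> 0) by nra.
    eapply differentiable_eq.
    + exact (differentiable_comp_1 _ (fun u v => 2 * u * / (1 - u ^ 2 - v ^ 2))
               _ _ _ _ _ Ha Hd).
    + unfold extremal_grad. cbn -[pow].
      field_simplify_eq; [ring | ].
      repeat split; try lra; nra.
    + unfold extremal_grad. cbn -[pow].
      field_simplify_eq; [ring | ].
      repeat split; try lra; nra.
  - eapply holo_eq.
    + apply (holo_mult (fun _ => RtoC (4 / PI)) (fun z => / (1 + z * z))%C).
      * apply holo_const.
      * exact Hinv.
    + cbv beta. ring.
  - apply continuous_Cmult; [apply continuous_const | ].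
    apply continuous_Cmult; [ | now apply continuous_Cmult].
    apply continuous_Cmult; [apply continuous_const | apply continuous_id].
Qed.

(** On the real axis the value at x = tan (PI t / 4) is t, by the formula for
    the tangent of the double angle. *)
Lemma extremal_onto : onto_interval extremal.
Proof.
  assert (HP := PI_RGT_0). intros t. split.
  - intros Ht. set (x := tan (PI * t / 4)).
    assert (Hx : -1 < x < 1).
    { assert (H1 : tan (PI * t / 4) < tan (PI / 4))
        by (apply tan_increasing; nra).
      assert (H2 : tan (- (PI / 4)) < tan (PI * t / 4))
        by (apply tan_increasing; nra).
      rewrite tan_neg in H2. rewrite tan_PI4 in H1, H2. fold x in H1, H2. lra. }
    exists (RtoC x). split.
    + apply unit_disk_norm2. cbn. nra.
    + unfold extremal. cbn [Re Im RtoC fst snd].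
      replace (2 * x / (1 - x ^ 2 - 0 ^ 2)) with (tan (PI * t / 2)).
      * rewrite atan_tan by nra. field. lra.
      * replace (PI * t / 2) with (2 * (PI * t / 4)) by field.
        assert (Hc1 : 0 < cos (PI * t / 4)) by (apply cos_gt_0; nra).
        assert (Hc2 : 0 < cos (2 * (PI * t / 4))) by (apply cos_gt_0; nra).
        rewrite tan_2a; try lra.
        -- unfold x. field. fold x. nra.
        -- fold x. nra.
  - intros (z & Hz & <-). unfold extremal.
    assert (Hb := atan_bound (2 * Re z / (1 - Re z ^ 2 - Im z ^ 2))).
    revert Hb. generalize (atan (2 * Re z / (1 - Re z ^ 2 - Im z ^ 2))).
    intros s Hs.
    split; apply Rmult_lt_reg_r with PI; auto;
      replace (2 / PI * s * PI) with (2 * s) by (field; lra); lra.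
Qed.

Lemma extremal_setting : setting (fun _ => True) (fun _ => 1) extremal.
Proof.
  assert (HC2 := harmonic_with_C2 _ _ _ extremal_harmonic).
  split; [apply open_true | ]. split; [apply connected_plane | ].
  split; [easy | ]. split; [ | split; [ | apply extremal_onto]].
  - split; [intros n; apply Cn_on_const | intros w _; lra].
  - split; [easy | ]. split; [exact HC2 | ].
    split; [apply (Cn_on_const 2 unit_disk 0) | ].
    intros z Hz.
    apply (real_harmonic_equation (fun _ => ln (1 ^ 2))); auto.
    unfold partial_u at 1, partial_v at 2. rewrite !Derive_const.
    rewrite (harmonic_with_laplacian _ _ _ z extremal_harmonic Hz).
    split; field.
Qed.

Lemma curvature_const (c : R) (w : C) : curvature (fun _ => c) w = 0.
Proof.
  unfold curvature, laplacian.
  rewrite (partial_u_ext _ (fun _ => 0)) by (intros z; exact (Derive_const (ln c) _)).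
  rewrite (partial_v_ext _ (fun _ => 0)) by (intros z; exact (Derive_const (ln c) _)).
  unfold partial_u, partial_v. rewrite !Derive_const. unfold Rdiv. ring.
Qed.

Lemma extremal_grad_norm : grad_norm extremal 0%C = 4 / PI.
Proof.
  assert (HP := PI_RGT_0).
  assert (H0 : unit_disk 0%C) by (apply unit_disk_norm2; cbn; lra).
  destruct (harmonic_with_partials _ _ _ _ extremal_harmonic H0) as (E1 & E2).
  unfold grad_norm. rewrite E1, E2.
  replace (extremal_grad 0%C) with (RtoC (4 / PI)).
  - cbn [Re Im RtoC fst snd].
    replace ((4 / PI) ^ 2 + (- 0) ^ 2) with ((4 / PI) ^ 2) by ring.
    apply sqrt_pow2. left. apply Rdiv_lt_0_compat; lra.
  - unfold extremal_grad. field.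
Qed.

Theorem theorem1p3 :
  (forall (Omega : C -> Prop) (varrho : C -> R) (f : C -> R),
     setting Omega varrho f ->
     real_harmonic strip (strip_density varrho) f /\
     ((forall w, strip w -> 0 <= curvature (strip_density varrho) w) ->
      forall z, unit_disk z ->
        grad_norm f z * ((1 - Cmod z ^ 2) / (1 - Rabs (f z) ^ 2)) <= 4 / PI)) /\
  (forall c : R,
     (forall (Omega : C -> Prop) (varrho : C -> R) (f : C -> R),
        setting Omega varrho f ->
        (forall w, strip w -> 0 <= curvature (strip_density varrho) w) ->
        forall z, unit_disk z ->
          grad_norm f z * ((1 - Cmod z ^ 2) / (1 - Rabs (f z) ^ 2)) <= c) ->
     4 / PI <= c).
Proof.
  split.
  - intros Omega varrho f Hset. split.
    + apply real_harmonic_strip with Omega; apply Hset.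
    + now apply strip_gradient_estimate with Omega.
  - intros c Hc.
    assert (H0 : unit_disk 0%C) by (apply unit_disk_norm2; cbn; lra).
    assert (Hcurv : forall w, strip w ->
                      0 <= curvature (strip_density (fun _ => 1)) w).
    { intros w _. right. symmetry. apply (curvature_const 1). }
    assert (H := Hc _ _ _ extremal_setting Hcurv 0%C H0).
    rewrite extremal_grad_norm, Cmod_0 in H.
    replace (extremal 0%C) with 0 in H.
    + rewrite Rabs_R0 in H.
      replace (4 / PI) with (4 / PI * ((1 - 0 ^ 2) / (1 - 0 ^ 2)))
        by (field; apply PI_neq0).
      exact H.
    + unfold extremal. cbn [Re Im RtoC fst snd].
      replace (2 * 0 / (1 - 0 ^ 2 - 0 ^ 2)) with 0 by field.
      rewrite atan_0. ring.
Qed.
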